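(* Let $H\subseteq G$ be an inclusion of countable discrete groups such that $L(H)'\cap L(G)=\mathbb{C}1$, and let $f\in L(H)'\cap\langle L(G),e_{L(H)}\rangle$ be a non-zero projection such that $\mathrm{Tr}(f)<\infty$. Then $\mathrm{Tr}(f)$ is an integer, and there exist $g_1,\ldots,g_n\in G$ such that the range of $f$ is the direct sum $\bigoplus_{i=1}^n\lambda_{g_i}\ell^2(H)$. In particular, the range of $f$ is a finite sum of $L(H)$-bimodules generated by double cosets $HgH$, each of which is a finite sum of right $L(H)$-modules generated by left cosets $gH$.
   Context: $\lambda$ is the left regular representation of $G$ on $\ell^2(G)$ (with canonical basis $\{\delta_g\}_{g\in G}$), $\lambda_s\delta_t=\delta_{st}$; $L(G)$ is the von Neumann algebra generated by $\{\lambda_g:g\in G\}$, and $L(H)\subseteq L(G)$ is the von Neumann subalgebra generated by $\{\lambda_h:h\in H\}$. $L^2(L(G))$ is identified with $\ell^2(G)$ and $L^2(L(H))$ with the closed subspace $\ell^2(H)\subseteq\ell^2(G)$. $e_{L(H)}$ is the orthogonal projection of $\ell^2(G)$ onto $\ell^2(H)$, $\langle L(G),e_{L(H)}\rangle$ is the von Neumann algebra on $\ell^2(G)$ generated by $L(G)$ and $e_{L(H)}$, and $\mathrm{Tr}$ is its unique faithful semifinite normal trace with $\mathrm{Tr}(e_{L(H)})=1$. Commutants are taken in $B(\ell^2(G))$. The left action of $L(H)$ on $\ell^2(G)$ is by left multiplication and the right action is by right multiplication (via $JL(H)J$, where $J$ is the conjugate linear isometry with $J(x\delta_e)=x^*\delta_e$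 for $x\in L(G)$). The (norm closed) module or bimodule generated by a coset or double coset $S\subseteq G$ is the norm closed $L(H)$-submodule (sub-bimodule) of $\ell^2(G)$ generated by $\{\delta_s:s\in S\}$. *)

(* Defs.v *)
From HB Require Import structures.
From mathcomp Require Import all_boot all_order all_algebra.
From mathcomp Require Import all_classical all_reals all_analysis.
From mathcomp Require Import complex ring lra.

Set Implicit Arguments.
Unset Strict Implicit.
Unset Printing Implicit Defensive.

Import Order.TTheory GRing.Theory Num.Theory.
Import numFieldNormedType.Exports.

Local Open Scope classical_set_scope.
Local Open Scope ring_scope.

Section complex_square.
Context {R : realType}.
Implicit Types (z w : R[i]) (r : R).

Definition sqnormc z : R := complex.Re z ^+ 2 + complex.Im z ^+ 2.

Lemma sqnormcE z : (sqnormc z)%:C%C = `|z| ^+ 2.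
Proof. by rewrite -add_Re2_Im2. Qed.

Lemma sqnormc_ge0 z : 0 <= sqnormc z.
Proof. by rewrite addr_ge0 // sqr_ge0. Qed.

Lemma sqnormcM z w : sqnormc (z * w) = sqnormc z * sqnormc w.
Proof.
by case: z w => a b [c d]; rewrite /sqnormc/=; ring.
Qed.

Lemma sqnormcJ z : sqnormc z^*%C = sqnormc z.
Proof. by case: z => a b; rewrite /sqnormc/= sqrrN. Qed.

Lemma sqnormcN z : sqnormc (- z) = sqnormc z.
Proof. by case: z => a b; rewrite /sqnormc/= !sqrrN. Qed.

Lemma sqnormc0 : sqnormc 0 = 0.
Proof. by rewrite /sqnormc/= expr0n addr0. Qed.

Lemma sqnormc_eq0 z : sqnormc z = 0 -> z = 0.
Proof.
move=> z0; apply/eqP; rewrite -normr_eq0 -sqrf_eq0 -sqnormcE z0.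
by rewrite eqxx.
Qed.

Lemma sqnormcD (t : R) z w : 0 < t ->
  sqnormc (z + w) <= (1 + t) * sqnormc z + (1 + t^-1) * sqnormc w.
Proof.
move=> t0; case: z w => a b [c d]; rewrite /sqnormc/= -subr_ge0.
have -> : (1 + t) * (a ^+ 2 + b ^+ 2) + (1 + t^-1) * (c ^+ 2 + d ^+ 2)
   - ((a + c) ^+ 2 + (b + d) ^+ 2)
   = t^-1 * ((t * a - c) ^+ 2 + (t * b - d) ^+ 2).
  by field; rewrite gt_eqF.
by rewrite mulr_ge0 ?invr_ge0 ?(ltW t0) // addr_ge0 // sqr_ge0.
Qed.

End complex_square.

Section l2_def.
Variables (R : realType) (T : choiceType).

Definition sqsum (xi : T -> R[i]) : \bar R :=
  (\esum_(t in [set: T]) (sqnormc (xi t))%:E)%E.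

Definition square_summable : pred (T -> R[i]) := fun xi => (sqsum xi < +oo)%E.

Record l2 := L2 { l2_fun :> T -> R[i] ; l2P : square_summable l2_fun }.

HB.instance Definition _ := [isSub for l2_fun].
HB.instance Definition _ := [Choice of l2 by <:].

End l2_def.

Section l2_theory.
Context {R : realType} {T : choiceType}.
Implicit Types (xi eta : l2 R T) (f g : T -> R[i]).

Lemma l2_ext xi eta : (forall t, xi t = eta t) -> xi = eta.
Proof. by move=> e; apply/val_inj/funext. Qed.

Lemma sqsum_ge0 f : (0 <= sqsum f)%E.
Proof. by apply: esum_ge0 => t _; rewrite lee_fin sqnormc_ge0. Qed.

Lemma sqsum_fin xi : sqsum xi \is a fin_num.
Proof. by rewrite ge0_fin_numE ?sqsum_ge0//; exact: l2P. Qed.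

Lemma le_sqsum f g : (forall t, sqnormc (f t) <= sqnormc (g t)) ->
  (sqsum f <= sqsum g)%E.
Proof. by move=> fg; apply: le_esum => t _; rewrite lee_fin. Qed.

Lemma esum_ge0Zl (k : R) (a : T -> R) : 0 <= k -> (forall t, 0 <= a t) ->
  (\esum_(t in [set: T]) (k * a t)%:E =
   k%:E * \esum_(t in [set: T]) (a t)%:E)%E.
Proof.
have le (l : R) (b : T -> R) : 0 <= l -> (forall t, 0 <= b t) ->
    (\esum_(t in [set: T]) (l * b t)%:E <=
    l%:E * \esum_(t in [set: T]) (b t)%:E)%E.
  move=> l0 b0; apply: ge_ereal_sup => _ [F fF <-].
  under eq_fsbigr do rewrite EFinM.
  have [finF _] := fF.
  rewrite -ge0_mule_fsumr; last by move=> ?; rewrite lee_fin.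
  by apply: lee_wpmul2l; [rewrite lee_fin|apply: esum_ge; exists F].
move=> k0 a0; apply/eqP; rewrite eq_le le//=.
have [->|kn0] := eqVneq k 0.
  by rewrite mul0e esum_ge0// => t _; rewrite mul0r.
have kgt0 : 0 < k by rewrite lt_neqAle eq_sym kn0.
rewrite -[leRHS]mul1e -(divff kn0) EFinM -muleA.
apply: lee_wpmul2l; first by rewrite lee_fin.
apply: le_trans (le (k^-1) (fun t => k * a t) _ _).
- by apply: le_esum => t _; rewrite mulrA mulVf// mul1r.
- by rewrite invr_ge0.
- by move=> t; rewrite mulr_ge0.
Qed.

Lemma sqsumD (t : R) f g : 0 < t ->
  (sqsum (fun x => (f x + g x)%R) <=
   (1 + t)%:E * sqsum f + (1 + t^-1)%:E * sqsum g)%E.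
Proof.
move=> t0.
have p1 : 0 <= 1 + t by rewrite addr_ge0// ltW.
have p2 : 0 <= 1 + t^-1 by rewrite addr_ge0// invr_ge0 ltW.
rewrite /sqsum -!esum_ge0Zl//; try by move=> ?; exact: sqnormc_ge0.
rewrite -esumD; last 2 first.
- by move=> x _; rewrite lee_fin mulr_ge0// sqnormc_ge0.
- by move=> x _; rewrite lee_fin mulr_ge0// sqnormc_ge0.
by apply: le_esum => x _; rewrite -EFinD lee_fin sqnormcD.
Qed.

Lemma sqsumZ (a : R[i]) f :
  sqsum (fun x => a * f x) = ((sqnormc a)%:E * sqsum f)%E.
Proof.
rewrite /sqsum -esum_ge0Zl ?sqnormc_ge0//; last by move=> ?; exact: sqnormc_ge0.
by apply: eq_esum => x _; rewrite sqnormcM.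
Qed.

Fact l2_zmod_closed : zmod_closed (@square_summable R T).
Proof.
split.
  rewrite unfold_in /square_summable /sqsum esum1//.
  by move=> t _; rewrite sqnormc0.
move=> f g; rewrite !unfold_in /square_summable => fo go.
have -> : f - g = (fun x => f x + (- g) x) by [].
apply: (le_lt_trans (sqsumD f (- g) ltr01)).
rewrite lte_add_pinfty// lte_mul_pinfty ?lee_fin//.
by rewrite (_ : sqsum (- g) = sqsum g)//; apply: eq_esum => t _; rewrite sqnormcN.
Qed.

HB.instance Definition _ :=
  GRing.isZmodClosed.Build (T -> R[i]) (@square_summable R T) l2_zmod_closed.
HB.instance Definition _ := [SubChoice_isSubZmodule of l2 R T by <:].

Lemma l2_fun0 t : (0 : l2 R T) t = 0. Proof. by []. Qed.
Lemma l2_funD xi eta t : (xi + eta) t = xi t + eta t. Proof. by []. Qed.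
Lemma l2_funN xi t : (- xi) t = - xi t. Proof. by []. Qed.

Fact l2_scale_subproof (a : R[i]) xi :
  square_summable (fun t => a * xi t).
Proof.
rewrite /square_summable sqsumZ lte_mul_pinfty ?lee_fin ?sqnormc_ge0//.
exact: l2P.
Qed.

Definition l2_scale (a : R[i]) xi : l2 R T := L2 (l2_scale_subproof a xi).

Fact l2_scaleA a b xi : l2_scale a (l2_scale b xi) = l2_scale (a * b) xi.
Proof. by apply: l2_ext => t /=; rewrite mulrA. Qed.
Fact l2_scale1 : left_id 1 l2_scale.
Proof. by move=> xi; apply: l2_ext => t /=; rewrite mul1r. Qed.
Fact l2_scaleDr : right_distributive l2_scale +%R.
Proof. by move=> a xi eta; apply: l2_ext => t; exact: mulrDr. Qed.
Fact l2_scaleDl xi : {morph l2_scale^~ xi : a b / a + b}.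
Proof. by move=> a b; apply: l2_ext => t; exact: mulrDl. Qed.

HB.instance Definition _ := GRing.Zmodule_isLmodule.Build R[i] (l2 R T)
  l2_scaleA l2_scale1 l2_scaleDr l2_scaleDl.

Lemma l2_funZ a xi t : (a *: xi) t = a * xi t. Proof. by []. Qed.

(* The norm is a real number, seen in the scalar field R[i]. *)
Definition l2_norm xi : R[i] := (Num.sqrt (fine (sqsum xi)))%:C%C.

Fact l2_norm0_eq0 xi : l2_norm xi = 0 -> xi = 0.
Proof.
move=> /(congr1 (@complex.Re R))/= /eqP.
rewrite sqrtr_eq0 => le0.
have s0 : sqsum xi = 0%E.
  apply/eqP; rewrite eq_le sqsum_ge0 andbT -[sqsum xi]fineK ?sqsum_fin//.
apply: l2_ext => t; rewrite l2_fun0; apply: sqnormc_eq0.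
apply/eqP; rewrite eq_le sqnormc_ge0 andbT.
suff : ((sqnormc (xi t))%:E <= sqsum xi)%E by rewrite s0 lee_fin.
rewrite -(@esum_set1 R T t (fun t => (sqnormc (xi t))%:E)) ?lee_fin ?sqnormc_ge0//.
rewrite /sqsum esum_mkcond.
apply: le_esum => x _; case: ifP => // _.
by rewrite lee_fin sqnormc_ge0.
Qed.

Fact l2_normZ a xi : l2_norm (a *: xi) = `|a| * l2_norm xi.
Proof.
rewrite /l2_norm (_ : sqsum (a *: xi) = sqsum (fun t => a * xi t))// sqsumZ.
rewrite fineM// ?sqsum_fin//= sqrtrM ?sqnormc_ge0// rmorphM/=.
by rewrite normc_def.
Qed.

Fact l2_normD xi eta : l2_norm (xi + eta) <= l2_norm xi + l2_norm eta.
Proof.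
rewrite /l2_norm -rmorphD lecR.
set A := Num.sqrt (fine (sqsum xi)); set B := Num.sqrt (fine (sqsum eta)).
have A2 : fine (sqsum xi) = A ^+ 2 by rewrite sqr_sqrtr// fine_ge0// sqsum_ge0.
have B2 : fine (sqsum eta) = B ^+ 2 by rewrite sqr_sqrtr// fine_ge0// sqsum_ge0.
have [A0|An0] := eqVneq A 0.
  have -> : xi = 0 by apply: l2_norm0_eq0; rewrite /l2_norm -/A A0.
  by rewrite add0r A0 add0r.
have [B0|Bn0] := eqVneq B 0.
  have -> : eta = 0 by apply: l2_norm0_eq0; rewrite /l2_norm -/B B0.
  by rewrite addr0 B0 addr0.
have Agt0 : 0 < A by rewrite lt_neqAle eq_sym An0 sqrtr_ge0.
have Bgt0 : 0 < B by rewrite lt_neqAle eq_sym Bn0 sqrtr_ge0.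
have -> : A + B = Num.sqrt ((A + B) ^+ 2).
  by rewrite sqrtr_sqr ger0_norm// addr_ge0// ltW.
apply: ler_wsqrtr.
have := sqsumD xi eta (divr_gt0 Bgt0 Agt0).
rewrite -[X in (_ * X + _)%E]fineK ?sqsum_fin// A2.
rewrite -[X in (_ + _ * X)%E]fineK ?sqsum_fin// B2.
rewrite (_ : sqsum (fun x => xi x + eta x) = sqsum (xi + eta))//.
rewrite -[X in (X <= _)%E]fineK ?sqsum_fin// lee_fin => /le_trans; apply.
by rewrite le_eqVlt; apply/orP; left; apply/eqP; field; rewrite An0 Bn0.
Qed.

HB.instance Definition _ := Lmodule_isNormed.Build R[i] (l2 R T)
  l2_normD l2_normZ l2_norm0_eq0.

End l2_theory.

Section inner_product.
Context {R : realType} {T : choiceType}.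
Implicit Types (xi eta : l2 R T).

(* Unconditional sums, of use only for absolutely summable families. *)
Definition rsum (f : T -> R) : R :=
  fine (esum [set: T] (EFin \o f)^\+ - esum [set: T] (EFin \o f)^\-)%E.

Definition csum (f : T -> R[i]) : R[i] :=
  (rsum (fun t => complex.Re (f t)) +i* rsum (fun t => complex.Im (f t)))%C.

Definition inner xi eta : R[i] := csum (fun t => xi t * (eta t)^*%C).

Lemma rsum_ge0 (f : T -> R) : (forall t, 0 <= f t) ->
  rsum f = fine (\esum_(t in [set: T]) (f t)%:E)%E.
Proof.
move=> f0; rewrite /rsum [X in (_ - X)%E]esum1 ?sube0; last first.
  by move=> t _; rewrite funenegE/= max_r// lee_fin lerNl oppr0.
congr fine; apply: eq_esum => t _.
by rewrite funeposE/= max_l// lee_fin.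
Qed.

Lemma rsum_oppr (f : T -> R) : (forall t, 0 <= f t) ->
  rsum (fun t => - f t) = - rsum f.
Proof.
move=> f0; rewrite (rsum_ge0 f0) /rsum [X in (X - _)%E]esum1 ?sub0e; last first.
  by move=> t _; rewrite funeposE/= max_r// lee_fin lerNl oppr0.
rewrite fineN; congr (- fine _); apply: eq_esum => t _.
by rewrite funenegE/= opprK max_l// lee_fin.
Qed.

Lemma rsum0 (f : T -> R) : (forall t, f t = 0) -> rsum f = 0.
Proof.
by move=> f0; rewrite rsum_ge0 ?esum1//= => t; rewrite f0.
Qed.

Lemma inner_norm xi : inner xi xi = `|xi| ^+ 2.
Proof.
have E t : xi t * (xi t)^*%C = (sqnormc (xi t))%:C%C.
  by rewrite sqnormcE sqr_normc.
rewrite /inner/csum; under [fun t => complex.Re _]eq_fun do rewrite E.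
under [fun t => complex.Im _]eq_fun do rewrite E.
rewrite /= [X in (_ +i* X)%C]rsum0// rsum_ge0; last by move=> t; exact: sqnormc_ge0.
rewrite [`|xi|]/(l2_norm xi) /l2_norm -rmorphXn/= sqr_sqrtr//.
by rewrite fine_ge0// sqsum_ge0.
Qed.

Fact delta_subproof (s : T) :
  square_summable (fun t => (t == s)%:R : R[i]).
Proof.
rewrite /square_summable /sqsum.
rewrite (_ : esum _ _ = \esum_(t in [set s]) 1%:E)%E; last first.
  rewrite [RHS]esum_mkcond; apply: eq_esum => t _.
  have [->|ts] := eqVneq t s; first by rewrite mem_set// /sqnormc/= expr1n expr0n addr0.
  by rewrite memNset ?sqnormc0// => /eqP; exact/negP.
by rewrite esum_set1 ?ltry// lee_fin ler01.
Qed.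

Definition delta (s : T) : l2 R T := L2 (delta_subproof s).

Lemma deltaE s t : delta s t = (t == s)%:R.
Proof. by []. Qed.

Lemma rsum_supp1 (f : T -> R) s : (forall t, t != s -> f t = 0) -> rsum f = f s.
Proof.
have key (g : T -> R) : (forall t, 0 <= g t) -> (forall t, t != s -> g t = 0) ->
    rsum g = g s.
  move=> g0 gs; rewrite rsum_ge0//.
  rewrite (_ : esum _ _ = \esum_(t in [set s]) (g t)%:E)%E; last first.
    rewrite [RHS]esum_mkcond; apply: eq_esum => t _.
    have [->|ts] := eqVneq t s; first by rewrite mem_set.
    by rewrite memNset ?gs// => /eqP; exact/negP.
  by rewrite esum_set1// lee_fin.
move=> fs; have [f0|f0] := leP 0 (f s).
  by apply: (key _ _ fs) => t; case: (eqVneq t s) => [->|/fs ->].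
have Nf0 t : 0 <= - f t.
  by case: (eqVneq t s) => [->|/fs->]; [rewrite oppr_ge0 ltW|rewrite oppr0].
have Nfs t : t != s -> - f t = 0 by move=> /fs ->; rewrite oppr0.
have := rsum_oppr Nf0; rewrite (key _ Nf0 Nfs) opprK => <-.
by congr rsum; apply/funext => t; rewrite opprK.
Qed.

Lemma csum_supp1 (f : T -> R[i]) s : (forall t, t != s -> f t = 0) -> csum f = f s.
Proof.
move=> fs; rewrite /csum !(@rsum_supp1 _ s) => [|t /fs->//|t /fs->//].
by case: (f s).
Qed.

Lemma inner_deltar xi s : inner xi (delta s) = xi s.
Proof.
rewrite /inner (@csum_supp1 _ s) ?deltaE ?eqxx ?conjc1 ?mulr1// => t ts.
by rewrite deltaE (negbTE ts) conjc0 mulr0.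
Qed.

Lemma inner_deltal xi s : inner (delta s) xi = (xi s)^*%C.
Proof.
rewrite /inner (@csum_supp1 _ s) ?deltaE ?eqxx ?mul1r// => t ts.
by rewrite deltaE (negbTE ts) mul0r.
Qed.

End inner_product.

Section operators.
Context {R : realType} {T : choiceType}.
Local Notation op := (l2 R T -> l2 R T).
Implicit Types (x y z : op) (S M : set op) (V : set (l2 R T)).

Definition bounded_op x : Prop :=
  linear x /\ exists C : R[i], forall xi, `|x xi| <= C * `|xi|.

Definition adjoint x y : Prop :=
  forall xi eta, inner (x xi) eta = inner xi (y eta).

Definition commutant S : set op :=
  [set x | bounded_op x /\ forall y, S y -> x \o y = y \o x].

(* A von Neumann algebra on l^2(T) is a self-adjoint set of bounded operators
   equal to its bicommutant; it is in particular a unital subalgebra. *)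
Definition von_neumann_algebra M : Prop :=
  (forall x y, M x -> bounded_op y -> adjoint x y -> M y) /\
  commutant (commutant M) = M.

Definition generated_vN S : set op := smallest von_neumann_algebra S.

Definition scalar_op : set op := [set x | exists c : R[i], x = c \*: idfun].

Definition projection x : Prop :=
  [/\ bounded_op x, x \o x = x & adjoint x x].

Definition positive_op x : Prop :=
  bounded_op x /\ forall xi, 0 <= inner (x xi) xi.

Definition op_le x y : Prop := positive_op (y \- x).

Definition positive_part M : set op := M `&` positive_op.

Definition op_directed S : Prop :=
  S !=set0 /\ forall x y, S x -> S y -> exists z, [/\ S z, op_le x z & op_le y z].

Definition op_lub M S x : Prop :=
  [/\ positive_part M x, forall y, S y -> op_le y x &
    forall z, positive_part M z -> (forall y, S y -> op_le y z) -> op_le x z].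

(* A trace on M is given by its values on the positive part of M; the values of
   Tr elsewhere are irrelevant. *)
Record fns_trace M (Tr : op -> \bar R) : Prop := FnsTrace {
  trace_ge0 : forall x, positive_part M x -> (0 <= Tr x)%E ;
  traceD : forall x y, positive_part M x -> positive_part M y ->
    Tr (x \+ y) = (Tr x + Tr y)%E ;
  traceZ : forall (a : R) x, 0 <= a -> positive_part M x ->
    Tr (a%:C%C \*: x) = (a%:E * Tr x)%E ;
  trace_tracial : forall x y, M x -> M y -> adjoint x y ->
    Tr (y \o x) = Tr (x \o y) ;
  trace_faithful : forall x, positive_part M x -> Tr x = 0%E -> x = \0 ;
  trace_normal : forall S x, S `<=` positive_part M -> op_directed S ->
    op_lub M S x -> Tr x = ereal_sup (Tr @` S) ;
  trace_semifinite : forall x, positive_part M x -> x <> \0 ->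
    exists y, [/\ positive_part M y, op_le y x, y <> \0 & (Tr y < +oo)%E]
}.

Definition subspace V : Prop :=
  V 0 /\ forall (a : R[i]) xi eta, V xi -> V eta -> V (a *: xi + eta).

Definition closed_submodule S V : Prop :=
  [/\ subspace V, closed V & forall x xi, S x -> V xi -> V (x xi)].

Definition generated_submodule S (A : set T) : set (l2 R T) :=
  smallest (closed_submodule S) (delta @` A).

Definition subspace_sum n (W : 'I_n -> set (l2 R T)) : set (l2 R T) :=
  [set xi | exists2 eta : 'I_n -> l2 R T,
     (forall i, W i (eta i)) & xi = \sum_(i < n) eta i].

(* Hilbert space direct sum, i.e. of pairwise orthogonal subspaces *)
Definition is_direct_sum V n (W : 'I_n -> set (l2 R T)) : Prop :=
  V = subspace_sum W /\
  forall i j, i != j -> forall xi eta, W i xi -> W j eta -> inner xi eta = 0.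

Definition supported_on (A : set T) : set (l2 R T) :=
  [set xi | forall t, ~ A t -> xi t = 0].

Fact l2_restrict_subproof (A : set T) (xi : l2 R T) :
  square_summable (fun t => if t \in A then xi t else 0).
Proof.
apply: le_lt_trans (l2P xi); apply: le_sqsum => t.
by case: ifP => // _; rewrite sqnormc0 sqnormc_ge0.
Qed.

Definition l2_restrict (A : set T) (xi : l2 R T) : l2 R T :=
  L2 (l2_restrict_subproof A xi).

Lemma l2_restrict_projection A :
  projection (l2_restrict A) /\ range (l2_restrict A) = supported_on A.
Proof.
have idem xi : supported_on A xi -> l2_restrict A xi = xi.
  move=> Axi; apply: l2_ext => t /=; case: ifPn => // /negP tA.
  by rewrite Axi// => At; apply: tA; rewrite inE.
have sup xi : supported_on A (l2_restrict A xi).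
  by move=> t At /=; rewrite memNset.
split; last first.
  apply/seteqP; split=> [_ [xi _ <-]//|xi Axi].
  by exists xi => //; exact: idem.
split.
- split; first move=> a xi eta.
    apply: l2_ext => t; rewrite l2_funD l2_funZ/=.
    by case: ifP; rewrite ?mulr0 ?addr0.
  exists 1 => xi; rewrite mul1r -[`|l2_restrict A xi|]/(l2_norm _).
  rewrite -[`|xi|]/(l2_norm _) lecR ler_wsqrtr// fine_le ?sqsum_fin//.
  by apply: le_sqsum => t /=; case: ifP => // _; rewrite sqnormc0 sqnormc_ge0.
- by apply/funext => xi; exact: idem.
- move=> xi eta; rewrite /inner; congr csum; apply/funext => t /=.
  by case: ifP; rewrite ?conjc0 ?mul0r ?mulr0.
Qed.

End operators.

Section group_operators.
Context {R : realType} {G : groupType}.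
Implicit Types (s t : G) (xi : l2 R G) (H A : set G).

Lemma sqsum_bij (f : G -> R[i]) (u v : G -> G) :
  cancel u v -> cancel v u -> sqsum (f \o u) = sqsum f.
Proof.
move=> uv vu; rewrite /sqsum [RHS](@reindex_esum _ _ _ setT setT u)//.
by split=> // [x y _ _ /(can_inj uv)//|y _]; exists (v y).
Qed.

Fact lambda_subproof s xi : square_summable (fun t => xi (s^-1 * t)%g).
Proof.
rewrite /square_summable.
by have := sqsum_bij xi (mulVKg s) (mulKg s); rewrite /comp => ->; exact: l2P.
Qed.

Definition lambda s xi : l2 R G := L2 (lambda_subproof s xi).

Lemma lambda_delta s t : lambda s (delta t) = delta (s * t)%g.
Proof.
apply: l2_ext => r /=; congr (_%:R); congr nat_of_bool.
by apply/eqP/eqP => [<-|->]; [rewrite mulVKg|rewrite mulKg].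
Qed.

Fact Jconj_subproof xi : square_summable (fun t => (xi (t^-1)%g)^*%C).
Proof.
rewrite /square_summable.
rewrite (_ : sqsum _ = sqsum (xi \o (fun t => t^-1)%g)).
  by rewrite (sqsum_bij _ (@invgK G) (@invgK G)); exact: l2P.
by apply: eq_esum => t _; rewrite sqnormcJ.
Qed.

(* The modular conjugation J; see Jconj_antilinear, Jconj_isometry and
   Jconj_adjoint. *)
Definition Jconj xi : l2 R G := L2 (Jconj_subproof xi).

(* L(H), as an algebra of operators on l^2(G) *)
Definition group_vN H : set (l2 R G -> l2 R G) :=
  generated_vN (lambda @` H).

(* J L(H) J, whose action on l^2(G) is the right action of L(H) *)
Definition right_group_vN H : set (l2 R G -> l2 R G) :=
  [set Jconj \o x \o Jconj | x in group_vN H].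

(* <L(G), e_{L(H)}>: by l2_restrict_projection, l2_restrict H is the orthogonal
   projection e_{L(H)} of l^2(G) onto l^2(H). *)
Definition basic_construction H : set (l2 R G -> l2 R G) :=
  generated_vN (group_vN [set: G] `|` [set l2_restrict H]).

Definition right_module H A : set (l2 R G) :=
  generated_submodule (right_group_vN H) A.

Definition bimodule H A : set (l2 R G) :=
  generated_submodule (group_vN H `|` right_group_vN H) A.

Lemma Jconj_antilinear (a : R[i]) xi eta :
  Jconj (a *: xi + eta) = a^*%C *: Jconj xi + Jconj eta.
Proof.
apply: l2_ext => t; rewrite l2_funD l2_funZ/=.
by rewrite rmorphD rmorphM.
Qed.

Lemma Jconj_isometry xi : `|Jconj xi| = `|xi|.
Proof.
rewrite -[`|Jconj xi|]/(l2_norm _) -[`|xi|]/(l2_norm _) /l2_norm.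
congr (Num.sqrt (fine _))%:C%C.
rewrite -(sqsum_bij xi (@invgK G) (@invgK G)).
by apply: eq_esum => t _; rewrite sqnormcJ.
Qed.

Lemma lambda_bounded s : bounded_op (lambda s).
Proof.
split; first by move=> a xi eta; apply: l2_ext => t.
exists 1 => xi; rewrite mul1r -[`|lambda s xi|]/(l2_norm _) -[`|xi|]/(l2_norm _).
rewrite /l2_norm lecR ler_wsqrtr// fine_le ?sqsum_fin//.
by have := sqsum_bij xi (mulVKg s) (mulKg s); rewrite /comp => ->.
Qed.

Let rho s := Jconj \o lambda s \o Jconj.

Let rhoE s xi t : rho s xi t = xi (t * s)%g.
Proof. by rewrite /rho/= conjcK invgM !invgK. Qed.

Let rho_bounded s : bounded_op (rho s).
Proof.
split.
  by move=> a xi eta; apply: l2_ext => t; rewrite l2_funD l2_funZ !rhoE.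
have [_ [C HC]] := lambda_bounded s.
exists C => xi; rewrite /rho/= Jconj_isometry.
by rewrite -[X in _ <= _ * X]Jconj_isometry.
Qed.

Let rsum_bij (f : G -> R) (u v : G -> G) :
  cancel u v -> cancel v u -> rsum (f \o u) = rsum f.
Proof.
move=> uv vu; have ub : set_bij setT setT u.
  by split=> // [x y _ _ /(can_inj uv)//|y _]; exists (v y).
rewrite /rsum [X in _ = fine (X - _)%E](reindex_esum _ _ _ _ ub).
rewrite [X in _ = fine (_ - X)%E](reindex_esum _ _ _ _ ub).
congr (fine (_ - _)%E); apply: eq_esum => t _.
- by rewrite !funeposE.
- by rewrite !funenegE.
Qed.

Let csum_bij (f : G -> R[i]) (u v : G -> G) :
  cancel u v -> cancel v u -> csum (f \o u) = csum f.
Proof.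
move=> uv vu; rewrite /csum -(rsum_bij (fun t => complex.Re (f t)) uv vu).
by rewrite -(rsum_bij (fun t => complex.Im (f t)) uv vu).
Qed.

Let rho_adjoint s : adjoint (rho s) (rho s^-1%g).
Proof.
move=> xi eta; rewrite /inner -(csum_bij _ (mulgVK s) (mulgK s)).
by congr csum; apply/funext => t; rewrite /comp !rhoE mulgVK.
Qed.

Lemma group_vN_comm_rho x s : group_vN [set: G] x -> x \o rho s = rho s \o x.
Proof.
suff vN : von_neumann_algebra (commutant (range rho)).
  move=> /(smallest_sub vN) [|_]; last by apply; exists s.
  move=> _ [r _ <-]; split; first exact: lambda_bounded.
  move=> _ [q _ <-]; apply/funext => xi; apply: l2_ext => t.
  rewrite /comp -[LHS]/(rho q xi (r^-1 * t)%g) !rhoE.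
  by rewrite -[RHS]/(xi (r^-1 * (t * q))%g) mulgA.
split.
  move=> y z [_ yC] zb yz; split=> // _ [q _ <-].
  apply/funext => xi; apply: l2_ext => t.
  rewrite -[LHS]conjcK -[RHS]conjcK -!inner_deltal; congr (_^*)%C.
  rewrite /comp -yz.
  rewrite -{1}(invgK q) -rho_adjoint.
  have /(congr1 (fun w => w (delta t))) := yC _ (imageT rho q^-1%g).
  by rewrite /comp => <-; rewrite yz rho_adjoint invgK.
apply/seteqP; split=> y [yb yC]; split=> // z zC.
  by apply: yC; split; [have [q _ <-] := zC; exact: rho_bounded|move=> w [_ ->]].
by have [_ ->] := zC.
Qed.

(* J (x delta_e) = x^* delta_e for x in L(G) *)
Lemma Jconj_adjoint x y : group_vN [set: G] x -> group_vN [set: G] y ->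
  adjoint x y -> Jconj (x (delta 1%g)) = y (delta 1%g).
Proof.
move=> xG yG xy; apply: l2_ext => t /=.
rewrite -inner_deltar xy inner_deltal conjcK.
have -> : delta t^-1%g = rho t (delta 1%g).
  apply: l2_ext => r; rewrite rhoE !deltaE; congr (nat_of_bool _)%:R.
  by apply/eqP/eqP => [->|/(canRL (mulgK t))]; rewrite ?mulVg ?mul1g.
have /(congr1 (fun w : l2 R G -> l2 R G => w (delta 1%g) 1%g)) := group_vN_comm_rho t yG.
by rewrite /comp rhoE mul1g.
Qed.

End group_operators.

Definition left_coset (G : groupType) (g : G) (H : set G) : set G :=
  [set (g * h)%g | h in H].

Definition double_coset (G : groupType) (H : set G) (g : G) : set G :=
  [set (h * g * k)%g | h in H & k in H].

(* Main.v *)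
Require Import Defs.
From HB Require Import structures.
From mathcomp Require Import all_boot all_order all_algebra.
From mathcomp Require Import all_classical all_reals all_analysis.
From mathcomp Require Import complex lra.

(** A projection [f] commuting with the left and right translations by [H] has
    matrix coefficients [<f d_x, d_y>] invariant under both.  For a left coset
    [gH] let [e_gH] be the projection onto [l^2(gH)], which has trace 1.  The
    traces of [f e_kH f], for the left cosets [kH] inside [HgH], are all equal and
    sum up to at most [Tr f]; so if [HgH] contains infinitely many left cosets,
    they vanish and [f d_g = 0].  If it contains finitely many, then
    [K = H `&` g H g^-1] has finite index in [H], and [t |-> (f d_g)(t g)] is a
    square summable function invariant under conjugation by [K].  Irreducibility
    says that the [H]-conjugacy orbits, hence the [K]-orbits, of elements other
    than 1 are infinite, so this function is supported at 1.  Thus [f] is diagonal,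
    i.e. the projection onto [l^2(S)] with [S] invariant under [H] on both sides,
    and [S] consists of at most [Tr f] left cosets. *)

Set Implicit Arguments.
Unset Strict Implicit.
Unset Printing Implicit Defensive.

Import Order.TTheory GRing.Theory Num.Theory.
Import numFieldNormedType.Exports.

Local Open Scope classical_set_scope.
Local Open Scope ring_scope.

(** * Summation over an arbitrary index set and sesquilinearity of the inner product *)

Section inner_product.
Context {R : realType} {T : choiceType}.
Implicit Types (xi eta zeta : l2 R T) (f g : T -> R).

(** [rsum] is defined through positive and negative parts, and [esumB] computes exactly that
    difference for [f \- g]. *)
Lemma rsumB_ge0 f g : (forall t, 0 <= f t) -> (forall t, 0 <= g t) ->
  summable setT (EFin \o f) -> summable setT (EFin \o g) ->
  rsum (f \- g) = rsum f - rsum g.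
Proof.
move=> f0 g0 sf sg; rewrite [in RHS]rsum_ge0// [in RHS]rsum_ge0// /rsum.
have fin (h : T -> R) : (forall t, 0 <= h t) -> summable setT (EFin \o h) ->
    (\esum_(t in [set: T]) (h t)%:E)%E \is a fin_num.
  move=> h0; rewrite summableE; congr (_ \is a fin_num).
  by apply: eq_esum => t _ /=; rewrite ger0_norm.
rewrite -fineB ?fin//; congr fine.
by rewrite -(esumB sf sg)// => t _; rewrite lee_fin.
Qed.

Lemma summable_max0 f : summable setT (EFin \o f) ->
  summable setT (EFin \o (fun t => Num.max (f t) 0)).
Proof.
apply: le_lt_trans; apply: le_esum => t _ /=; rewrite lee_fin.
by case: (leP (f t) 0) => _; rewrite ?normr0.
Qed.

(** Splitting each function as [p h \- p (\- h)] presents [f \+ g] as a difference of two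
    non-negative summable functions, which reduces the claim to [rsumB_ge0]. *)
Lemma rsumD f g : summable setT (EFin \o f) -> summable setT (EFin \o g) ->
  rsum (f \+ g) = rsum f + rsum g.
Proof.
move=> sf sg.
have sN (h : T -> R) : summable setT (EFin \o h) ->
    summable setT (EFin \o (\- h)).
  by rewrite summableN.
pose p (h : T -> R) t := Num.max (h t) 0.
have p0 h t : 0 <= p h t by rewrite /p le_max lexx orbT.
have sp h : summable setT (EFin \o h) -> summable setT (EFin \o p h).
  exact: summable_max0.
have dec h : h = p h \- p (\- h).
  apply/funext => t; rewrite /p/=.
  by case: (leP (h t) 0) => h0; case: (leP (- h t) 0) => h1; lra.
have sD (h k : T -> R) : summable setT (EFin \o h) ->
    summable setT (EFin \o k) -> summable setT (EFin \o (h \+ k)).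
  exact: summableD.
have D (h k : T -> R) : (forall t, 0 <= h t) -> (forall t, 0 <= k t) ->
    summable setT (EFin \o h) -> summable setT (EFin \o k) ->
    rsum (h \+ k) = rsum h + rsum k.
  move=> h0 k0 sh sk; rewrite -[rsum k]opprK -rsum_oppr//.
  (* [- k] is the difference of the non-negative functions [h] and [h \+ k], so additivity in the
     non-negative case comes out of [rsumB_ge0]. *)
  have -> : rsum (fun t => - k t) = rsum (h \- (h \+ k)).
    by congr rsum; apply/funext => t /=; lra.
  rewrite rsumB_ge0//; [lra|by move=> t; exact: addr_ge0|exact: sD].
have -> : f \+ g = (p f \+ p g) \- (p (\- f) \+ p (\- g)).
  by apply/funext => t; rewrite {1}(dec f) {1}(dec g)/=; lra.
rewrite rsumB_ge0; try (by move=> t; exact: addr_ge0); last 2 first.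
- by apply: sD; exact: sp.
- by apply: sD; apply/sp/sN.
rewrite !D//; try (by apply/sp); try (by apply/sp/sN).
rewrite {3}(dec f) {3}(dec g) !rsumB_ge0//; try (by apply/sp); try (by apply/sp/sN).
lra.
Qed.

(** Pointwise, the real and imaginary parts are bounded by the sum of the two squared moduli. The
    squares given to [nra] supply $2|uv|\le u^2+v^2$ for each product of a coordinate of [xi t] with
    one of [eta t]. *)
Lemma summable_inner xi eta :
  summable setT (EFin \o (fun t => complex.Re (xi t * (eta t)^*%C))) /\
  summable setT (EFin \o (fun t => complex.Im (xi t * (eta t)^*%C))).
Proof.
have lt : (sqsum xi + sqsum eta < +oo)%E by rewrite lte_add_pinfty//; exact: l2P.
split; apply: le_lt_trans lt; rewrite /sqsum -esumD => [|t _|t _];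
  try (by rewrite lee_fin sqnormc_ge0); apply: le_esum => t _ /=;
  rewrite -EFinD lee_fin ler_norml; case: (xi t) (eta t) => a b [c d];
  rewrite /sqnormc/=; apply/andP; split;
  have := (sqr_ge0 (a + c), sqr_ge0 (a - c), sqr_ge0 (a + d), sqr_ge0 (a - d));
  have := (sqr_ge0 (b + c), sqr_ge0 (b - c), sqr_ge0 (b + d), sqr_ge0 (b - d));
  rewrite !sqrrD !sqrrN => -[[[? ?] ?] ?] [[[? ?] ?] ?]; nra.
Qed.

Lemma csumD (f g : T -> R[i]) :
  summable setT (EFin \o (fun t => complex.Re (f t))) ->
  summable setT (EFin \o (fun t => complex.Im (f t))) ->
  summable setT (EFin \o (fun t => complex.Re (g t))) ->
  summable setT (EFin \o (fun t => complex.Im (g t))) ->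
  csum (f \+ g) = csum f + csum g.
Proof.
move=> f1 f2 g1 g2; rewrite /csum.
rewrite (_ : (fun t => complex.Re _) =
  (fun t => complex.Re (f t)) \+ (fun t => complex.Re (g t))); last first.
  by apply/funext => t /=; case: (f t) (g t) => a b [].
rewrite (_ : (fun t => complex.Im _) =
  (fun t => complex.Im (f t)) \+ (fun t => complex.Im (g t))); last first.
  by apply/funext => t /=; case: (f t) (g t) => a b [].
by rewrite !rsumD.
Qed.

Lemma innerDl xi eta zeta : inner (xi + eta) zeta = inner xi zeta + inner eta zeta.
Proof.
have [? ?] := summable_inner xi zeta; have [? ?] := summable_inner eta zeta.
rewrite /inner -csumD//; congr csum; apply/funext => t /=.
by rewrite -mulrDl.
Qed.

Lemma innerDr xi eta zeta : inner xi (eta + zeta) = inner xi eta + inner xi zeta.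
Proof.
have [? ?] := summable_inner xi eta; have [? ?] := summable_inner xi zeta.
rewrite /inner -csumD//; congr csum; apply/funext => t /=.
by rewrite -mulrDr -rmorphD.
Qed.

Lemma inner_disjoint xi eta : (forall t, xi t = 0 \/ eta t = 0) ->
  inner xi eta = 0.
Proof.
move=> d; have z t : xi t * (eta t)^*%C = 0.
  by have [->|->] := d t; rewrite ?mul0r// conjc0 mulr0.
rewrite /inner /csum !rsum0 // => t; by rewrite z.
Qed.

(** This is what makes left and right translations unitary. *)
Lemma inner_bij xi eta xi' eta' (u v : T -> T) : cancel u v -> cancel v u ->
  (forall t, xi' t = xi (u t)) -> (forall t, eta' t = eta (u t)) ->
  inner xi' eta' = inner xi eta.
Proof.
move=> uv vu xiE etaE.
have ub : set_bij setT setT u.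
  by split=> // [x y _ _ /(can_inj uv)//|y _]; exists (v y).
have rsum_bij (f : T -> R) : rsum (f \o u) = rsum f.
  rewrite /rsum [X in _ = fine (X - _)%E](reindex_esum _ _ _ _ ub).
  rewrite [X in _ = fine (_ - X)%E](reindex_esum _ _ _ _ ub).
  by congr (fine (_ - _)%E); apply: eq_esum => t _; rewrite ?funeposE ?funenegE.
by rewrite /inner /csum; congr (_ +i* _)%C; rewrite -[RHS]rsum_bij;
  congr rsum; apply/funext => t /=; rewrite xiE etaE.
Qed.

End inner_product.

(** * Bounded operators, commutants and generated von Neumann algebras *)

Section operator_algebra.
Context {R : realType} {T : choiceType}.
Local Notation op := (l2 R T -> l2 R T).
Implicit Types (x y z : op) (S M : set op) (A B : set T) (xi eta : l2 R T).

Lemma op_eqP x y : (forall xi t, x xi t = y xi t) -> x = y.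
Proof. by move=> xy; apply/funext => xi; apply: l2_ext => t. Qed.

(** The constant [C] may be replaced by its modulus: a vector with [xi] of non-zero norm forces
    [0 <= C], and for the others both bounds are zero. *)
Lemma bounded_opP x : bounded_op x <->
  linear x /\ exists2 C : R[i], 0 <= C & forall xi, `|x xi| <= C * `|xi|.
Proof.
split=> [[lx [C xC]]|[lx [C _ xC]]]; last by split => //; exists C.
split=> //; exists `|C| => // xi; have := xC xi.
have [->|xi0] := eqVneq `|xi| 0; first by rewrite !mulr0.
move=> le; have C0 : 0 <= C.
  have xigt0 : 0 < `|xi| by rewrite lt_neqAle eq_sym xi0 normr_ge0.
  by rewrite -(pmulr_lge0 _ xigt0); exact: le_trans le.
by rewrite ger0_norm.
Qed.

Lemma linear_opD x : linear x -> forall xi eta, x (xi + eta) = x xi + x eta.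
Proof. by move=> lx xi eta; have := lx 1 xi eta; rewrite !scale1r. Qed.

Lemma linear_op0 x : linear x -> x 0 = 0.
Proof.
move=> lx; have := linear_opD lx 0 0; rewrite addr0 => /eqP.
by rewrite -subr_eq subrr => /eqP.
Qed.

Lemma linear_opZ x : linear x -> forall a xi, x (a *: xi) = a *: x xi.
Proof. by move=> lx a xi; have := lx a xi 0; rewrite !addr0 linear_op0 ?addr0. Qed.

Lemma linear_opN x : linear x -> forall xi, x (- xi) = - x xi.
Proof. by move=> lx xi; rewrite -scaleN1r linear_opZ// scaleN1r. Qed.

Lemma bounded_op_id : bounded_op (idfun : op).
Proof. by split=> [//|]; exists 1 => xi; rewrite mul1r. Qed.

Lemma bounded_op0 : bounded_op (\0 : op).
Proof.
split; first by move=> a xi eta /=; rewrite scaler0 addr0.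
by exists 0 => xi; rewrite mul0r normr0.
Qed.

Lemma bounded_op_comp x y : bounded_op x -> bounded_op y -> bounded_op (x \o y).
Proof.
move=> /bounded_opP[lx [C C0 xC]] [ly [D yD]]; split.
  by move=> a xi eta; rewrite /= ly lx.
exists (C * D) => xi /=; apply: le_trans (xC _) _.
by rewrite -mulrA ler_wpM2l.
Qed.

Lemma bounded_opD x y : bounded_op x -> bounded_op y -> bounded_op (x \+ y).
Proof.
move=> [lx [C xC]] [ly [D yD]]; split.
  by move=> a xi eta; rewrite /= ly lx scalerDr addrACA.
exists (C + D) => xi /=; rewrite mulrDl.
by apply: le_trans (ler_normD _ _) _; exact: lerD.
Qed.

Lemma bounded_opN x : bounded_op x -> bounded_op (\- x).
Proof.
move=> [lx [C xC]]; split; last by exists C => xi /=; rewrite normrN.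
by move=> a xi eta; rewrite /= lx opprD scalerN.
Qed.

Lemma adjoint_comp x x' y y' :
  adjoint x x' -> adjoint y y' -> adjoint (x \o y) (y' \o x').
Proof. by move=> xx yy xi eta /=; rewrite xx yy. Qed.

(** Coordinates are conjugates of inner products with [delta t], so commutation of the adjoint [z]
    with [s] is that of [y] with [s'], tested on [delta t]. The bicommutant identity is $S'''=S'$.
    With [smallest_sub], this lemma carries commutation relations from generators to the algebra
    they generate. *)
Lemma commutant_vN S :
  (forall s, S s -> bounded_op s) ->
  (forall s, S s -> exists2 s', S s' & adjoint s' s /\ adjoint s s') ->
  von_neumann_algebra (commutant S).
Proof.
move=> Sb Sadj; split.
  move=> y z [_ yC] zb yz; split=> // s Ss.
  have [s' Ss' [s's ss']] := Sadj s Ss.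
  apply: op_eqP => xi t /=; rewrite -[LHS]conjcK -[RHS]conjcK -!inner_deltal.
  congr (_^*)%C; rewrite -yz -s's -s's -yz.
  by have /(congr1 (fun w : op => w (delta t))) := yC _ Ss' => /= ->.
apply/seteqP; split=> y [yb yC]; split=> // z zC.
  by apply: yC; split; [exact: Sb|move=> w [_ ->]].
by have [_ ->] := zC.
Qed.

Lemma generated_vN_incl S x : S x -> generated_vN S x.
Proof. by move=> Sx M [_]; apply. Qed.

Lemma commutant_id S : commutant S idfun.
Proof. by split; first exact: bounded_op_id. Qed.

Lemma commutant_comp S x y : commutant S x -> commutant S y -> commutant S (x \o y).
Proof.
move=> [xb xC] [yb yC]; split; first exact: bounded_op_comp.
move=> z Sz; rewrite -[LHS]/(x \o (y \o z)) yC// -[LHS]/((x \o z) \o y).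
by rewrite xC.
Qed.

Lemma commutantD S x y : (forall z, S z -> linear z) ->
  commutant S x -> commutant S y -> commutant S (x \+ y).
Proof.
move=> Sl [xb xC] [yb yC]; split; first exact: bounded_opD.
move=> z Sz; apply/funext => xi /=; rewrite (linear_opD (Sl z Sz)).
have /(congr1 (fun w : op => w xi)) /= -> := xC z Sz.
by have /(congr1 (fun w : op => w xi)) /= -> := yC z Sz.
Qed.

Lemma commutantN S x : (forall z, S z -> linear z) ->
  commutant S x -> commutant S (\- x).
Proof.
move=> Sl [xb xC]; split; first exact: bounded_opN.
move=> z Sz; apply/funext => xi /=; rewrite (linear_opN (Sl z Sz)).
by have /(congr1 (fun w : op => w xi)) /= -> := xC z Sz.
Qed.

(** The bounded operators form the commutant of the identity, hence a von Neumann algebra containing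
    [S]. *)
Lemma generated_vN_bounded S x : generated_vN S x ->
  (forall s, S s -> bounded_op s) -> bounded_op x.
Proof.
move=> Sx Sb.
have vN : von_neumann_algebra (commutant ([set idfun] : set op)).
  apply: commutant_vN => [_ ->|_ ->]; first exact: bounded_op_id.
  by exists idfun.
have := smallest_sub vN _ Sx; case=> // s Ss; split; first exact: Sb.
by move=> _ ->.
Qed.

(** Every von Neumann algebra is the commutant of its own commutant, so it inherits the closure
    properties of commutants. The next three lemmas use the same argument. *)
Lemma generated_vN_id S : generated_vN S idfun.
Proof. by move=> M [[_ <-] _]; exact: commutant_id. Qed.

Lemma generated_vN_comp S x y :
  generated_vN S x -> generated_vN S y -> generated_vN S (x \o y).
Proof.
move=> Sx Sy M HM; have := Sx M HM; have := Sy M HM.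
by case: HM => [[_ <-] _] My Mx; exact: commutant_comp.
Qed.

Lemma generated_vND S x y :
  generated_vN S x -> generated_vN S y -> generated_vN S (x \+ y).
Proof.
move=> Sx Sy M HM; have := Sx M HM; have := Sy M HM.
by case: HM => [[_ <-] _] My Mx; apply: commutantD => // z [[]].
Qed.

Lemma generated_vNN S x : generated_vN S x -> generated_vN S (\- x).
Proof.
move=> Sx M HM; have := Sx M HM.
by case: HM => [[_ <-] _] Mx; apply: commutantN => // z [[]].
Qed.

End operator_algebra.

(** * The subspaces $\ell^2(A)$ and the projections onto them *)

Section supports.
Context {R : realType} {T : choiceType}.
Local Notation op := (l2 R T -> l2 R T).
Implicit Types (A B : set T) (xi eta : l2 R T) (V : set (l2 R T)).

Lemma l2_restrictE A xi t : l2_restrict A xi t = if t \in A then xi t else 0.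
Proof. by []. Qed.

Lemma l2_restrict_bounded A : bounded_op (@l2_restrict R T A).
Proof. by have [[]] := @l2_restrict_projection R T A. Qed.

Lemma l2_restrict_adjoint A : adjoint (@l2_restrict R T A) (l2_restrict A).
Proof. by have [[]] := @l2_restrict_projection R T A. Qed.

Lemma l2_restrict_idem A xi : l2_restrict A (l2_restrict A xi) = l2_restrict A xi.
Proof. by apply: l2_ext => t; rewrite !l2_restrictE; case: (t \in A). Qed.

Lemma supported_on_restrict A xi : supported_on A (l2_restrict A xi).
Proof. by move=> t At; rewrite l2_restrictE memNset. Qed.

Lemma l2_restrict_supported A xi : supported_on A xi -> l2_restrict A xi = xi.
Proof.
move=> Axi; apply: l2_ext => t; rewrite l2_restrictE; case: ifPn => //.
by rewrite notin_setE => /Axi ->.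
Qed.

Lemma l2_restrictU A B : A `&` B = set0 ->
  l2_restrict (A `|` B) = l2_restrict A \+ l2_restrict B :> op.
Proof.
move=> AB; apply: op_eqP => xi t; rewrite l2_funD !l2_restrictE in_setU.
have [tA|] := boolP (t \in A); have [tB|] := boolP (t \in B) => //=;
  rewrite ?addr0 ?add0r//.
have : (A `&` B) t by split; exact/set_mem.
by rewrite AB.
Qed.

Lemma delta_supported A t : A t -> supported_on A (@delta R T t).
Proof.
by move=> At s As; rewrite deltaE; case: eqVneq => // st; case: As; rewrite st.
Qed.

Lemma l2_funsum n (eta : 'I_n -> l2 R T) t :
  (\sum_(i < n) eta i) t = \sum_(i < n) eta i t.
Proof. by elim/big_rec2: _ => // i a b _ <-. Qed.

Lemma subspace_supported_on A : Defs.subspace (@supported_on R T A).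
Proof.
split=> [//|a xi eta Axi Aeta t At].
by rewrite l2_funD l2_funZ Axi// Aeta// mulr0 addr0.
Qed.

Lemma sqnormc_le_sqsum xi t : sqnormc (xi t) <= fine (sqsum xi).
Proof.
rewrite -lee_fin fineK ?sqsum_fin//.
rewrite -(@esum_set1 R T t (fun t => (sqnormc (xi t))%:E)) ?lee_fin ?sqnormc_ge0//.
rewrite /sqsum esum_mkcond; apply: le_esum => x _; case: ifP => // _.
by rewrite lee_fin sqnormc_ge0.
Qed.

(** Evaluation at a point is dominated by the norm, so a coordinate that vanishes on $\ell^2(A)$
    vanishes on its closure. *)
Lemma closed_supported_on A : closed (@supported_on R T A).
Proof.
apply/closure_id/seteqP; split; first exact: subset_closure.
move=> xi cl t At; apply: sqnormc_eq0; apply/eqP; rewrite eq_le sqnormc_ge0 andbT.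
apply/ler_addgt0Pr => e e0; rewrite add0r.
have e'0 : (0 : R[i]) < (Num.sqrt e)%:C%C by rewrite ltcR sqrtr_gt0.
have [eta [Aeta]] := cl _ (nbhsx_ballx xi _ e'0).
rewrite -ball_normE /ball_/= -[`|_|]/(l2_norm _) /l2_norm ltcR => /ltW le.
have -> : xi t = (xi - eta) t by rewrite l2_funD l2_funN Aeta// subr0.
apply: le_trans (sqnormc_le_sqsum _ _) _.
by move: le; rewrite ler_sqrt// ltW.
Qed.

Lemma sqsumID A xi :
  fine (sqsum xi) = fine (\esum_(t in A) (sqnormc (xi t))%:E)%E +
                    fine (sqsum (l2_restrict (~` A) xi)).
Proof.
have p t : (0 <= (sqnormc (xi t))%:E)%E by rewrite lee_fin sqnormc_ge0.
rewrite -fineD ?sqsum_fin//; last first.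
  rewrite ge0_fin_numE ?esum_ge0//; apply: le_lt_trans (l2P xi).
  by rewrite esum_mkcond; apply: le_esum => t _; case: ifP.
rewrite {1}/sqsum (esumID A)// !setTI; congr (fine (_ + _)%E).
rewrite esum_mkcond; apply: eq_esum => t _; rewrite l2_restrictE.
by case: ifP; rewrite ?sqnormc0.
Qed.

(** The restrictions of [xi] to finite sets are linear combinations of vectors [delta t] with [t] in
    [A], and they approximate [xi] in norm. *)
Lemma supported_on_sub A V : Defs.subspace V -> closed V -> delta @` A `<=` V ->
  supported_on A `<=` V.
Proof.
move=> [V0 VD] clV AV xi Axi.
have finV (s : seq T) : V (l2_restrict [set` s] xi).
  elim: s => [|x s IH].
    rewrite (_ : l2_restrict _ xi = 0)//; apply: l2_ext => t.
    by rewrite l2_restrictE memNset.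
  have [xs|xs] := boolP (x \in s).
    rewrite (_ : [set` x :: s] = [set` s])//; apply/seteqP.
    by split=> t /=; rewrite inE; [case/orP => // /eqP ->|move=> ->; rewrite orbT].
  have -> : l2_restrict [set` x :: s] xi =
      xi x *: delta x + l2_restrict [set` s] xi.
    apply: l2_ext => t; rewrite l2_funD l2_funZ !l2_restrictE deltaE.
    rewrite (_ : (t \in [set` x :: s]) = (t == x) || (t \in s)); last first.
      by apply/idP/idP; rewrite inE /= inE.
    rewrite (_ : (t \in [set` s]) = (t \in s)); last by apply/idP/idP; rewrite inE.
    have [->|tx] /= := eqVneq t x; first by rewrite mulr1 (negbTE xs) addr0.
    by rewrite mulr0 add0r.
  have [Ax|Ax] := pselect (A x); first by apply: VD => //; apply: AV; exists x.
  by rewrite Axi// scale0r add0r.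
move/closure_id : clV => ->; move=> B /nbhs_ballP[e e0 eB].
(* The radius is a positive element of [R[i]], hence a real number. *)
have eR : e = (complex.Re e)%:C%C by rewrite RRe_real// gtr0_real.
pose r := complex.Re e; have r0 : 0 < r by move: e0; rewrite /= eR ltcR.
(* A finite set [F] carries all but less than $r^2$ of the squared norm, so the tail outside [F] has
   norm less than $r$. *)
have /ereal_sup_gt[_ [F [finF _] <-] lt] :
    ((fine (sqsum xi) - r ^+ 2)%:E < sqsum xi)%E.
  rewrite -[ltRHS]fineK ?sqsum_fin// lte_fin; have := exprn_gt0 2 r0; lra.
have [s sF] := (finite_seqP F).1 finF.
exists (l2_restrict [set` s] xi); split; first exact: finV.
apply: eB; rewrite -ball_normE /ball_/= eR -/r.
have -> : xi - l2_restrict [set` s] xi = l2_restrict (~` F) xi.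
  apply: l2_ext => t; rewrite l2_funD l2_funN !l2_restrictE -sF in_setC.
  by case: (t \in F); rewrite ?subrr// subr0.
rewrite -[`|_|]/(l2_norm _) /l2_norm ltcR -[ltRHS](ger0_norm (ltW r0)) -sqrtr_sqr.
rewrite ltr_sqrt ?exprn_gt0//.
have p t : (0 <= (sqnormc (xi t))%:E)%E by rewrite lee_fin sqnormc_ge0.
have sumF : (\esum_(t in F) (sqnormc (xi t))%:E =
    \sum_(t \in F) (sqnormc (xi t))%:E)%E.
  by rewrite esum_fset.
have := sqsumID F xi; move: lt; rewrite -sumF.
rewrite -[X in (_ < X)%E]fineK ?lte_fin.
  by move=> lt eq; lra.
rewrite ge0_fin_numE ?esum_ge0//; apply: le_lt_trans (l2P xi).
by rewrite esum_mkcond; apply: le_esum => t _; case: ifP.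
Qed.

Lemma subspace_sum_supported_on n (A : 'I_n -> set T) :
  subspace_sum (fun i => supported_on (A i)) =
  supported_on (\bigcup_i A i) :> set (l2 R T).
Proof.
apply/seteqP; split=> [_ [eta etaA ->] t At|xi Axi].
  by rewrite l2_funsum big1// => i _; apply: etaA => Ai; apply: At; exists i.
(* The sets [A i] may overlap. [pick] assigns each point of their union to one index, so the [B i]
   are disjoint, lie in [A i] and have the same union. *)
pose B i := [set t | [pick j | t \in A j] = Some i].
exists (fun i => l2_restrict (B i) xi).
  move=> i t At; rewrite l2_restrictE memNset// /B/=.
  by case: pickP => // j tj [ji]; apply: At; rewrite -ji; exact: set_mem.
apply: l2_ext => t; rewrite l2_funsum.
under eq_bigr do rewrite l2_restrictE.
case E : [pick j | t \in A j] => [i|].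
  rewrite (bigD1 i)//= mem_set ?big1 ?addr0// => j ji.
  by rewrite memNset// /B/= E => -[ij]; rewrite ij eqxx in ji.
rewrite big1 => [|i _]; last by rewrite memNset// /B/= E.
apply: Axi => -[i _ Ai]; move: E; case: pickP => // /(_ i).
by rewrite mem_set.
Qed.

End supports.

(** * Left and right translations on $\ell^2(G)$ *)

Section translations.
Context {R : realType} {G : groupType}.
Local Notation op := (l2 R G -> l2 R G).
Implicit Types (s t g h : G) (xi eta : l2 R G) (A B : set G).

(** The right regular representation, obtained from the left one through the modular conjugation. *)
Definition rho s : op := Jconj \o lambda s \o Jconj.

Lemma lambdaE s xi t : lambda s xi t = xi (s^-1 * t)%g.
Proof. by []. Qed.

Lemma rhoE s xi t : rho s xi t = xi (t * s)%g.
Proof. by rewrite /rho/= conjcK invgM !invgK. Qed.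

Lemma rho_bounded s : bounded_op (rho s).
Proof.
have [_ [C HC]] := @lambda_bounded R G s; split.
  by move=> a xi eta; apply: l2_ext => t; rewrite l2_funD l2_funZ !rhoE.
exists C => xi; rewrite /rho/= Jconj_isometry.
by rewrite -[X in _ <= _ * X]Jconj_isometry.
Qed.

Lemma lambda1 : lambda 1%g = idfun :> op.
Proof. by apply: op_eqP => xi t; rewrite lambdaE invg1 mul1g. Qed.

Lemma lambdaM s t : lambda (s * t)%g = lambda s \o lambda t :> op.
Proof. by apply: op_eqP => xi r /=; rewrite invgM mulgA. Qed.

Lemma lambda_rho s t : lambda s \o rho t = rho t \o lambda s :> op.
Proof.
apply: op_eqP => xi r; rewrite [RHS]rhoE -[LHS]/(rho t xi (s^-1 * r)%g).
by rewrite rhoE /= mulgA.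
Qed.

Lemma rho_delta s t : rho s (delta t) = delta (t * s^-1)%g :> l2 R G.
Proof.
apply: l2_ext => r; rewrite rhoE !deltaE; congr (nat_of_bool _)%:R.
by apply/eqP/eqP => [<-|->]; rewrite ?mulgK ?mulgVK.
Qed.

Lemma lambda_adjoint s : adjoint (@lambda R G s) (lambda s^-1%g).
Proof.
move=> xi eta; symmetry.
apply: (inner_bij (mulKg s) (mulVKg s)) => t; first by rewrite lambdaE mulKg.
by rewrite lambdaE invgK.
Qed.

Lemma rho_adjoint s : adjoint (rho s) (rho s^-1%g).
Proof.
move=> xi eta; symmetry.
apply: (inner_bij (mulgVK s) (mulgK s)) => t; first by rewrite rhoE mulgVK.
by rewrite rhoE.
Qed.

Lemma lambda_restrict s A B : (forall t, A t <-> B (s * t)%g) ->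
  lambda s \o l2_restrict A = l2_restrict B \o lambda s :> op.
Proof.
move=> AB; apply: op_eqP => xi t; rewrite /comp lambdaE !l2_restrictE lambdaE.
have {}AB : A (s^-1 * t)%g <-> B t by rewrite AB mulVKg.
by congr (if _ then _ else _); apply/idP/idP => /set_mem tA; apply/mem_set/AB.
Qed.

Lemma rho_restrict s A B : (forall t, B t <-> A (t * s)%g) ->
  rho s \o l2_restrict A = l2_restrict B \o rho s :> op.
Proof.
move=> AB; apply: op_eqP => xi t; rewrite /comp rhoE !l2_restrictE rhoE.
congr (if _ then _ else _); apply/idP/idP => /set_mem tA; apply/mem_set.
  exact/AB.
exact: (AB t).1.
Qed.

Lemma lambda_supported_on s A B : (forall t, A t <-> B (s * t)%g) ->
  lambda s @` supported_on A = supported_on B :> set (l2 R G).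
Proof.
move=> AB; apply/seteqP; split=> [_ [xi Axi <-] t Bt|xi Bxi].
  by rewrite lambdaE Axi// => /AB; rewrite mulVKg.
exists (lambda s^-1%g xi).
  by move=> t At; rewrite lambdaE invgK Bxi// => /AB.
by apply: l2_ext => t; rewrite !lambdaE invgK mulVKg.
Qed.

Lemma Jconj_supported_on A xi : supported_on A xi ->
  supported_on [set t | A (t^-1)%g] (Jconj xi).
Proof. by move=> Axi t At /=; rewrite Axi// conjc0. Qed.

End translations.

(** * Modules over $L(H)$, the basic construction and infinite conjugacy orbits *)

Section subgroup.
Context {R : realType} {G : groupType} (H : groupClosed G).
Local Notation op := (l2 R G -> l2 R G).
Implicit Types (s t g h : G) (xi eta : l2 R G) (A B : set G).

Lemma group_vN_lambda A h : A h -> @group_vN R G A (lambda h).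
Proof. by move=> Ah; apply: generated_vN_incl; exists h. Qed.

(** [commutant S] is a von Neumann algebra, so commutation needs checking on the generators
    [lambda h] only. *)
Lemma group_vN_commutant (S : set op) A (x : op) :
  (forall y, S y -> bounded_op y) ->
  (forall y, S y -> exists2 y', S y' & adjoint y' y /\ adjoint y y') ->
  (forall h y, A h -> S y -> lambda h \o y = y \o lambda h) ->
  @group_vN R G A x -> commutant S x.
Proof.
move=> Sb Sadj SA; apply: (smallest_sub (commutant_vN Sb Sadj)).
by move=> _ [h Ah <-]; split; [exact: lambda_bounded|move=> y Sy; exact: SA].
Qed.

Lemma group_vN_restrict A (x : op) :
  (forall h t, h \in H -> A t <-> A (h * t)%g) ->
  @group_vN R G [set` H] x -> x \o l2_restrict A = l2_restrict A \o x.
Proof.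
move=> HA Hx; suff [_] : commutant [set l2_restrict A] x by apply.
apply: group_vN_commutant Hx => [_ ->|_ ->|h _ Hh ->].
- exact: l2_restrict_bounded.
- by exists (l2_restrict A) => //; split; exact: l2_restrict_adjoint.
- by apply: lambda_restrict => t; exact: HA.
Qed.

Lemma group_vN_supported_on A (x : op) xi :
  (forall h t, h \in H -> A t <-> A (h * t)%g) ->
  @group_vN R G [set` H] x -> supported_on A xi -> supported_on A (x xi).
Proof.
move=> HA Hx Axi; rewrite -(l2_restrict_supported Axi).
have /(congr1 (fun w : op => w xi)) /= -> := group_vN_restrict HA Hx.
exact: supported_on_restrict.
Qed.

(** [Jconj] exchanges $\ell^2(A)$ and $\ell^2(A^{-1})$, and $A^{-1}$ is invariant under left
    multiplication by [H], which reduces to the left action. *)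
Lemma right_group_vN_supported_on A (x : op) xi :
  (forall h t, h \in H -> A t <-> A (t * h)%g) ->
  @right_group_vN R G [set` H] x -> supported_on A xi -> supported_on A (x xi).
Proof.
move=> AH [y Hy <-] Axi /=.
have HA h t : h \in H -> A (t^-1)%g <-> A ((h * t)^-1)%g.
  by move=> Hh; rewrite invgM; apply: AH; rewrite gpredV.
have := group_vN_supported_on HA Hy (Jconj_supported_on Axi).
move=> /Jconj_supported_on; congr (supported_on _ _).
by apply/funext => t /=; rewrite invgK.
Qed.

(** $\ell^2(A)$ is itself a closed submodule containing the generators, and [supported_on_sub] puts
    it inside every other one. All modules of the theorem are computed in this way. *)
Lemma generated_submodule_supported_on (S : set op) A :
  (forall x xi, S x -> supported_on A xi -> supported_on A (x xi)) ->
  generated_submodule S A = supported_on A :> set (l2 R G).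
Proof.
move=> SA; apply/seteqP; split.
  apply: smallest_sub => [|_ [t At <-]]; last exact: delta_supported.
  by split; [exact: subspace_supported_on|exact: closed_supported_on|].
move=> xi Axi V [[sV clV _] AV]; exact: (supported_on_sub sV clV AV).
Qed.

Lemma right_moduleE A : (forall h t, h \in H -> A t <-> A (t * h)%g) ->
  right_module [set` H] A = supported_on A :> set (l2 R G).
Proof.
by move=> AH; apply: generated_submodule_supported_on => x xi;
  exact: right_group_vN_supported_on.
Qed.

Lemma bimoduleE A : (forall h t, h \in H -> A t <-> A (h * t)%g) ->
  (forall h t, h \in H -> A t <-> A (t * h)%g) ->
  bimodule [set` H] A = supported_on A :> set (l2 R G).
Proof.
move=> HA AH; apply: generated_submodule_supported_on => x xi [].
  exact: group_vN_supported_on.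
exact: right_group_vN_supported_on.
Qed.

(** Right translations by [H] commute with both kinds of generators: with left translations, and
    with the projection onto $\ell^2(H)$ because $Hh=H$. *)
Lemma basic_construction_rho h (x : op) : h \in H ->
  basic_construction [set` H] x -> x \o rho h = rho h \o x.
Proof.
move=> Hh Mx; pose S : set op := rho @` [set` H].
suff [_] : commutant S x by apply; exists h.
have Sb y : S y -> bounded_op y by move=> [k _ <-]; exact: rho_bounded.
have Sadj y : S y -> exists2 y', S y' & adjoint y' y /\ adjoint y y'.
  move=> [k Hk <-]; exists (rho k^-1%g).
    by exists k^-1%g => //=; rewrite gpredV.
  by split; [rewrite -{2}(invgK k)|]; exact: rho_adjoint.
apply: (smallest_sub (commutant_vN Sb Sadj)) Mx => y [|->].
  by apply: group_vN_commutant => // k _ _ [l _ <-]; exact: lambda_rho.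
split; first exact: l2_restrict_bounded.
move=> _ [k Hk <-]; symmetry; apply: rho_restrict => t.
by split=> /= tH; [exact: gpredM|rewrite -(mulgK k t) gpredM// gpredV].
Qed.

Lemma sum_lambda_group_vN (s : seq G) A : (forall g, g \in s -> A g) ->
  @group_vN R G A (fun xi => \sum_(g <- s) lambda g xi).
Proof.
elim: s => [|g s IH] sA.
  have -> : (fun xi => \sum_(g <- [::]) lambda g xi) = idfun \+ (\- idfun) :> op.
    by apply/funext => xi /=; rewrite big_nil subrr.
  by apply: generated_vND; [|apply: generated_vNN]; exact: generated_vN_id.
have -> : (fun xi => \sum_(k <- g :: s) lambda k xi) =
    lambda g \+ (fun xi => \sum_(k <- s) lambda k xi) :> op.
  by apply/funext => xi /=; rewrite big_cons.
apply: generated_vND; first by apply: group_vN_lambda; apply: sA; exact: mem_head.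
by apply: IH => k ks; apply: sA; rewrite inE ks orbT.
Qed.

Lemma sum_lambda_adjoint (s : seq G) :
  adjoint (fun xi => \sum_(g <- s) lambda g xi : l2 R G)
          (fun xi => \sum_(g <- s) lambda g^-1%g xi).
Proof.
elim: s => [|g s IH] xi eta.
  by rewrite !big_nil !inner_disjoint// => t; [right|left].
by rewrite !big_cons innerDl innerDr lambda_adjoint IH.
Qed.

(* A finite conjugacy orbit [s] yields the element [sum_(g in s) lambda g] of
   L(H)' in L(G), which is not a scalar. *)
Lemma irreducible_infinite_orbit g :
  commutant (@group_vN R G [set` H]) `&` @group_vN R G [set: G] = scalar_op ->
  g != 1%g -> infinite_set [set (h * g * h^-1)%g | h in [set` H]].
Proof.
move=> irr g1 /finite_seqP[s0 s0E]; pose s := undup s0.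
have us : uniq s by exact: undup_uniq.
have sP k : k \in s <-> exists2 h, h \in H & (h * g * h^-1)%g = k.
  rewrite mem_undup; have -> : (k \in s0 : Prop) = [set` s0] k by [].
  by rewrite -s0E; split=> -[h]; exists h.
(* Conjugation by an element of [H] permutes the orbit [s]. *)
have conj_s (F : G -> l2 R G) h : h \in H ->
    \sum_(k <- s) F (h * k * h^-1)%g = \sum_(k <- s) F k.
  move=> Hh; rewrite -(big_map (fun k => (h * k * h^-1)%g) xpredT F).
  apply: perm_big; apply: uniq_perm => //.
    by rewrite map_inj_uniq// => k l /mulIg /mulgI.
  move=> k; apply/mapP/idP => [[l /sP[h' Hh' <-] ->]|/sP[h' Hh' <-]].
    by apply/sP; exists (h * h')%g; rewrite ?gpredM// invgM !mulgA.
  exists (h^-1 * h' * g * (h^-1 * h')^-1)%g.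
    by apply/sP; exists (h^-1 * h')%g => //; rewrite gpredM// gpredV.
  by rewrite invgM invgK !mulgA mulgV mul1g mulgK.
pose x : op := fun xi => \sum_(k <- s) lambda k xi.
pose y : op := fun xi => \sum_(k <- s) lambda k^-1%g xi.
have Gx : group_vN [set: G] x by exact: sum_lambda_group_vN.
have bx : bounded_op x.
  by apply: generated_vN_bounded Gx _ => _ [k _ <-]; exact: lambda_bounded.
have yE : y = fun xi => \sum_(k <- map (fun k => k^-1)%g s) lambda k xi.
  by apply/funext => xi; rewrite big_map.
have Gy : group_vN [set: G] y by rewrite yE; exact: sum_lambda_group_vN.
have b_y : bounded_op y.
  by apply: generated_vN_bounded Gy _ => _ [k _ <-]; exact: lambda_bounded.
have xy : adjoint x y by exact: sum_lambda_adjoint.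
have yx : adjoint y x.
  move=> xi eta; rewrite yE sum_lambda_adjoint big_map.
  by under eq_bigr do rewrite invgK.
have lambda_sum (F : G -> G) h xi : lambda h (\sum_(k <- s) lambda (F k) xi) =
    \sum_(k <- s) lambda (h * F k * h^-1)%g (lambda h xi).
  have [lin _] := @lambda_bounded R G h.
  rewrite (big_morph _ (linear_opD lin) (linear_op0 lin)).
  apply: eq_bigr => k _; rewrite -[LHS]/((lambda h \o lambda (F k)) xi) -lambdaM.
  by rewrite -[RHS]/((lambda _ \o lambda h) xi) -lambdaM mulgVK.
have comx : commutant (@group_vN R G [set` H]) x.
  (* The adjoint [y] is included to make the set closed under adjoints, as [group_vN_commutant]
     requires. *)
  split=> // z Hz; suff [_ zC] : commutant [set x; y] z.
    by rewrite zC//; left.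
  apply: group_vN_commutant Hz => [_ [->|->]//|_ [->|->]|h _ Hh [->|->]].
  - by exists y; [right|].
  - by exists x; [left|].
  - by apply/funext => xi; rewrite /x/= (lambda_sum id)
      (conj_s (fun k => lambda k (lambda h xi))).
  - apply/funext => xi; rewrite /y/= (lambda_sum (fun k => k^-1)%g).
    rewrite -(conj_s (fun k => lambda k^-1%g (lambda h xi)) h Hh).
    by apply: eq_bigr => k _; rewrite !invgM invgK mulgA.
have : (commutant (@group_vN R G [set` H]) `&` group_vN [set: G]) x by [].
rewrite irr => -[c xE].
(* The coefficient at [g] is 0 for a scalar operator, since [g] is not 1, while it is 1 for [x],
   since [g] occurs exactly once in [s]. *)
have : x (delta 1%g) g = c * delta 1%g g by rewrite xE.
rewrite deltaE (negbTE g1) mulr0 /x.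
have -> : (\sum_(k <- s) lambda k (delta 1%g)) g = \sum_(k <- s) (g == k)%:R :> R[i].
  elim/big_rec2: _ => // k a b _ <-.
  by rewrite l2_funD lambda_delta deltaE mulg1.
have gs : g \in s by apply/sP; exists 1%g; rewrite ?gpred1// mul1g invg1 mulg1.
rewrite (bigD1_seq g)//= eqxx big1 ?addr0 => [|k kg].
  by move/eqP; rewrite oner_eq0.
by rewrite eq_sym (negbTE kg).
Qed.

End subgroup.

(** * Left cosets and double cosets *)

Section cosets.
Context {G : groupType} (H : groupClosed G).
Implicit Types (g h k t : G) (s : seq G).

Local Notation "g *H" := (left_coset g [set` H]) (at level 10, format "g *H").

Lemma left_cosetP g t : g*H t <-> (g^-1 * t)%g \in H.
Proof.
split=> [[h Hh <-]|gt]; first by rewrite mulKg.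
by exists (g^-1 * t)%g; rewrite ?mulVKg.
Qed.

Lemma left_coset_refl g : g*H g.
Proof. by apply/left_cosetP; rewrite mulVg gpred1. Qed.

Lemma left_coset_eq g k : g*H k -> g*H = k*H.
Proof.
move=> [h Hh <-]; apply/seteqP; split=> t /left_cosetP gt; apply/left_cosetP.
  by rewrite invgM -mulgA gpredM// gpredV.
by rewrite -[t](mulVKg (g * h)%g) -!mulgA mulKg gpredM.
Qed.

Lemma left_coset_mulr g h t : h \in H -> g*H t <-> g*H (t * h)%g.
Proof.
move=> Hh; split=> /left_cosetP gt; apply/left_cosetP.
  by rewrite mulgA gpredM.
by rewrite -(mulgK h t) mulgA gpredM// gpredV.
Qed.

(** The choice depends on the coset alone, so sets of cosets can be encoded, counted and compared as
    sets of representatives in [G]. *)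
Definition coset_rep g : G := xget 1%g (g*H).

Lemma coset_rep_mem g : g*H (coset_rep g).
Proof. exact: (xgetI _ (left_coset_refl g)). Qed.

Lemma coset_repP g k : coset_rep g = coset_rep k <-> g*H k.
Proof.
split=> [gk|/left_coset_eq]; last by rewrite /coset_rep => ->.
rewrite (left_coset_eq (coset_rep_mem g)) gk -(left_coset_eq (coset_rep_mem k)).
exact: left_coset_refl.
Qed.

Lemma coset_rep_idem g : coset_rep (coset_rep g) = coset_rep g.
Proof. by symmetry; apply/coset_repP; exact: coset_rep_mem. Qed.

Lemma double_coset_mull g h t : h \in H ->
  double_coset [set` H] g t <-> double_coset [set` H] g (h * t)%g.
Proof.
move=> Hh; split=> -[a Ha [b Hb E]].
  by exists (h * a)%g; [rewrite /= gpredM|exists b => //; rewrite -E !mulgA].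
exists (h^-1 * a)%g; first by rewrite /= gpredM// gpredV.
by exists b => //; rewrite -!mulgA [(a * _)%g]mulgA E mulKg.
Qed.

Lemma double_coset_mulr g h t : h \in H ->
  double_coset [set` H] g t <-> double_coset [set` H] g (t * h)%g.
Proof.
move=> Hh; split=> -[a Ha [b Hb E]]; exists a => //.
  by exists (b * h)%g; [rewrite /= gpredM|rewrite -E !mulgA].
by exists (b * h^-1)%g; [rewrite /= gpredM// gpredV|rewrite mulgA E mulgK].
Qed.

Lemma double_coset_refl g : double_coset [set` H] g g.
Proof.
exists 1%g; first exact: gpred1.
by exists 1%g; [exact: gpred1|rewrite mulg1 mul1g].
Qed.

Definition coset_union s : set G := [set t | exists2 g, g \in s & g*H t].

Lemma coset_union_cons g s : coset_union (g :: s) = g*H `|` coset_union s.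
Proof.
apply/seteqP; split=> t.
  by move=> [k /[!inE] /orP[/eqP ->|ks] kt]; [left|right; exists k].
move=> [gt|[k ks kt]]; first by exists g => //; exact: mem_head.
by exists k => //; rewrite inE ks orbT.
Qed.

Lemma coset_union_disjoint g s : coset_rep g \notin map coset_rep s ->
  g*H `&` coset_union s = set0.
Proof.
move=> gs; apply/seteqP; split=> // t [/coset_repP gt [k ks /coset_repP kt]].
by move/negP: gs; apply; apply/mapP; exists k => //; rewrite gt kt.
Qed.

(* The orbit of [g H] under left multiplication by [H] is [H/K], where
   [K = H `&` g H g^-1]; if it is finite then [K] has finite index in [H]. *)
Lemma finite_conj_orbit g y : finite_set (coset_rep @` double_coset [set` H] g) ->
  finite_set [set (k * y * k^-1)%g | k in
               [set k | k \in H /\ (g^-1 * k * g)%g \in H]] ->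
  finite_set [set (h * y * h^-1)%g | h in [set` H]].
Proof.
move=> finQ finK.
(* [h_ q] is a chosen element of [H] carrying [g*H] to the coset represented by [q]. Any [h] in [H]
   is [h_ q] times an element of $K$, so [c] maps pairs (coset, point of the $K$-orbit) onto a set
   containing the $H$-orbit. *)
pose h_ q := xget 1%g [set h | h \in H /\ coset_rep (h * g)%g = q].
pose c (z : G * G) := (h_ z.1 * z.2 * (h_ z.1)^-1)%g.
apply: sub_finite_set (finite_image c (finite_setX finQ finK)).
move=> _ [h Hh <-]; pose q := coset_rep (h * g)%g.
have [Hq hq] : h_ q \in H /\ coset_rep (h_ q * g)%g = q.
  by apply: (@xgetI _ _ [set h | h \in H /\ coset_rep (h * g)%g = q] h).
have /left_cosetP Kq := (coset_repP _ _).1 hq.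
exists (q, (((h_ q)^-1 * h) * y * ((h_ q)^-1 * h)^-1)%g).
  split=> /=.
    by exists (h * g)%g => //; exists h => //; exists 1%g; rewrite ?mulg1//= gpred1.
  exists ((h_ q)^-1 * h)%g => //; split; first by rewrite gpredM// gpredV.
  by move: Kq; rewrite invgM !mulgA.
by rewrite /c/= invgM invgK !mulgA mulgV mul1g mulgK.
Qed.

End cosets.

(** * Finiteness of the fibers of a square summable function *)

Section square_summable_fibers.
Context {R : realType} {T : choiceType}.

Lemma infinite_set_seq (A : set T) n : infinite_set A ->
  exists s : seq T, [/\ uniq s, (n <= size s)%N & {in s, forall t, A t}].
Proof.
move=> /(infinite_set_fset n)[B BA nB]; exists (finmap.enum_fset B).
by split=> //; exact: finmap.fset_uniq.
Qed.

(** Each point of the fiber contributes the same positive amount $|v|^2$ to the finite squared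
    norm. *)
Lemma finite_fiber_l2 (xi : l2 R T) (v : R[i]) : v != 0 ->
  finite_set [set t | xi t = v].
Proof.
move=> v0; apply: contrapT => inf.
have c0 : 0 < sqnormc v.
  rewrite lt_neqAle sqnormc_ge0 andbT eq_sym.
  by apply: contraNN v0 => /eqP/sqnormc_eq0 ->.
pose n := (Num.truncn (fine (sqsum xi) / sqnormc v)).+1.
have [s [us ns sv]] := infinite_set_seq n inf.
have : (((size s)%:R * sqnormc v)%:E <= sqsum xi)%E.
  apply: esum_ge; exists [set` s] => //.
  rewrite -fsbig_seq// (eq_big_seq (fun=> (sqnormc v)%:E)).
    by rewrite sumEFin big_const_seq count_predT iter_addr addr0 mulr_natl.
  by move=> t /sv /= ->.
rewrite -[X in (_ <= X)%E]fineK ?sqsum_fin// lee_fin; apply/negP; rewrite -ltNge.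
rewrite -ltr_pdivrMr//; apply: lt_le_trans (truncnS_gt _) _.
by rewrite ler_nat.
Qed.

End square_summable_fibers.

(** * Traces of coset projections and of their compressions by $f$ *)

Section trace.
Context {R : realType} {G : groupType} (H : groupClosed G).
Variable Tr : (l2 R G -> l2 R G) -> \bar R.
Hypothesis trace_Tr : fns_trace (basic_construction [set` H]) Tr.
Hypothesis Tr_e : Tr (l2_restrict [set` H]) = 1%E.

Local Notation op := (l2 R G -> l2 R G).
Local Notation M := (@basic_construction R G [set` H]).
Local Notation "g *H" := (left_coset g [set` H]) (at level 10, format "g *H").
Implicit Types (g h k t : G) (s : seq G) (x y : op) (A B : set G).

Lemma basic_construction_lambda g : M (lambda g).
Proof. by apply: generated_vN_incl; left; exact: group_vN_lambda. Qed.

Lemma l2_restrict_coset g :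
  l2_restrict (g*H) = lambda g \o l2_restrict [set` H] \o lambda g^-1%g :> op.
Proof.
rewrite (@lambda_restrict _ _ g [set` H] (g*H)) => [|t].
  by rewrite -compA -lambdaM mulgV lambda1.
by rewrite left_cosetP mulKg.
Qed.

Lemma basic_construction_coset g : M (l2_restrict (g*H)).
Proof.
rewrite l2_restrict_coset; apply: generated_vN_comp.
  apply: generated_vN_comp; first exact: basic_construction_lambda.
  by apply: generated_vN_incl; right.
exact: basic_construction_lambda.
Qed.

Lemma basic_construction_coset_union s : uniq (map (coset_rep H) s) ->
  M (l2_restrict (coset_union H s)).
Proof.
elim: s => [_|g s IH /= /andP[gs us]].
  have -> : l2_restrict (coset_union H [::]) = idfun \+ (\- idfun) :> op.
    by apply: op_eqP => xi t; rewrite l2_restrictE memNset /= ?subrr// => -[].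
  by apply: generated_vND; [|apply: generated_vNN]; exact: generated_vN_id.
rewrite coset_union_cons l2_restrictU ?coset_union_disjoint//.
by apply: generated_vND; [exact: basic_construction_coset|exact: IH].
Qed.

Lemma l2_restrictC A : l2_restrict (~` A) = idfun \+ (\- l2_restrict A) :> op.
Proof.
apply: op_eqP => xi t; rewrite l2_funD l2_funN !l2_restrictE in_setC.
by case: (t \in A); rewrite ?subrr ?subr0.
Qed.

(** With $x=\lambda_g e$ and $y=e\lambda_g^{-1}$, where $e$ is the projection onto $\ell^2(H)$, one
    has $yx=e$ and $xy=e_{gH}$; traciality concludes. *)
Lemma trace_coset g : Tr (l2_restrict (g*H)) = 1%E.
Proof.
have Mg := basic_construction_lambda g.
have Mg' := basic_construction_lambda g^-1%g.
have Me : M (l2_restrict [set` H]) by apply: generated_vN_incl; right.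
pose x : op := lambda g \o l2_restrict [set` H].
pose y : op := l2_restrict [set` H] \o lambda g^-1%g.
have xy : adjoint x y.
  by apply: adjoint_comp; [exact: lambda_adjoint|exact: l2_restrict_adjoint].
have := trace_tracial trace_Tr (generated_vN_comp Mg Me) (generated_vN_comp Me Mg') xy.
have -> : y \o x = l2_restrict [set` H].
  apply/funext => xi; rewrite /y/x/=.
  rewrite -[X in l2_restrict _ X]/((lambda g^-1%g \o lambda g) _).
  by rewrite -lambdaM mulVg lambda1 /= l2_restrict_idem.
rewrite Tr_e => ->; rewrite l2_restrict_coset; congr Tr.
by apply/funext => xi; rewrite /y/x/= l2_restrict_idem.
Qed.

Variable f : op.
Hypothesis f_comm : commutant (group_vN [set` H]) f.
Hypothesis Mf : M f.
Hypothesis f_proj : projection f.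

Let f_bounded : bounded_op f. Proof. by case: f_proj. Qed.
Let f_linear : linear f. Proof. by case: f_bounded. Qed.
Let f_idem xi : f (f xi) = f xi.
Proof. by case: f_proj => _ /(congr1 (fun x : op => x xi)). Qed.
Let f_adj : adjoint f f. Proof. by case: f_proj. Qed.

(** For a union $A$ of left cosets, the trace of this operator measures the part of $f$ carried by
    $A$. *)
Definition compression A : op := f \o l2_restrict A \o f.

(** This gives positivity of the compression, and also $e_A f=0$ once the compression vanishes. *)
Lemma inner_compression A xi :
  inner (compression A xi) xi = `|l2_restrict A (f xi)| ^+ 2.
Proof.
rewrite -inner_norm [RHS]l2_restrict_adjoint l2_restrict_idem.
by rewrite -l2_restrict_adjoint /compression/= f_adj.
Qed.

Lemma compression_pos A : M (l2_restrict A) -> positive_part M (compression A).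
Proof.
move=> MA; split.
  by apply: generated_vN_comp => //; exact: generated_vN_comp.
split=> [|xi]; last by rewrite inner_compression exprn_ge0.
by do !apply: bounded_op_comp => //; exact: l2_restrict_bounded.
Qed.

Lemma compressionU A B : A `&` B = set0 ->
  compression (A `|` B) = compression A \+ compression B.
Proof.
move=> AB; apply/funext => xi; rewrite /compression l2_restrictU//=.
by rewrite (linear_opD f_linear).
Qed.

Lemma trace_compression_union s : uniq (map (coset_rep H) s) ->
  Tr (compression (coset_union H s)) = (\sum_(g <- s) Tr (compression (g*H)))%E.
Proof.
elim: s => [_|g s IH /= /andP[gs us]].
  rewrite big_nil; have -> : compression (coset_union H [::]) = \0.
    apply/funext => xi; rewrite /compression/= -(linear_op0 f_linear).
    by congr (f _); apply: l2_ext => t; rewrite l2_restrictE memNset// => -[].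
  have pos0 : positive_part M (\0 : op).
    split; last split; first last.
    - by move=> xi; rewrite inner_disjoint// => t; left.
    - exact: bounded_op0.
    have -> : \0 = idfun \+ (\- idfun) :> op by apply/funext => xi /=; rewrite subrr.
    by apply: generated_vND; [|apply: generated_vNN]; exact: generated_vN_id.
  (* The value 0 at the zero operator comes from homogeneity with the scalar 0. *)
  rewrite -(mul0e (Tr \0)) -(traceZ trace_Tr (lexx 0) pos0).
  by congr Tr; apply/funext => xi /=; rewrite scaler0.
rewrite coset_union_cons compressionU ?coset_union_disjoint// big_cons -IH//.
apply: (traceD trace_Tr).
  by apply: compression_pos; exact: basic_construction_coset.
by apply: compression_pos; exact: basic_construction_coset_union.
Qed.

(** Compressing by the union of the cosets and by its complement splits $f$ into two positive
    operators. *)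
Lemma trace_compression_le s : uniq (map (coset_rep H) s) ->
  (\sum_(g <- s) Tr (compression (g*H)) <= Tr f)%E.
Proof.
move=> us; have Ms := basic_construction_coset_union us.
have MsC : M (l2_restrict (~` coset_union H s)).
  rewrite l2_restrictC; apply: generated_vND; first exact: generated_vN_id.
  exact: generated_vNN.
rewrite -trace_compression_union//.
have -> : f = compression (coset_union H s) \+ compression (~` coset_union H s).
  rewrite -compressionU ?setICr// setUv; apply/funext => xi.
  rewrite /compression/= (_ : l2_restrict setT (f xi) = f xi) ?f_idem//.
  by apply: l2_ext => t; rewrite l2_restrictE mem_set.
rewrite (traceD trace_Tr); try exact: compression_pos.
by rewrite leeDl// (trace_ge0 trace_Tr)//; exact: compression_pos.
Qed.

Lemma f_lambda h xi : h \in H -> f (lambda h xi) = lambda h (f xi).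
Proof.
move=> Hh; have [_ /(_ (lambda h))] := f_comm.
by move=> /(_ (group_vN_lambda Hh))/(congr1 (fun x : op => x xi)).
Qed.

Lemma f_rho h xi : h \in H -> f (rho h xi) = rho h (f xi).
Proof.
by move=> Hh; have /(congr1 (fun x : op => x xi)) := basic_construction_rho Hh Mf.
Qed.

(** Both sides equal $\mathrm{Tr}(e_{gH}fe_{gH})$ by traciality. For the left one, take $x=\lambda_h
    f e_{gH}$ and $y=e_{gH}f\lambda_h^{-1}$: as $f$ commutes with $\lambda_h$, $xy=fe_{hgH}f$. *)
Lemma trace_compression_lambda h g : h \in H ->
  Tr (compression ((h * g)%g*H)) = Tr (compression (g*H)).
Proof.
move=> Hh; have Mg := basic_construction_coset g.
have Mh := basic_construction_lambda h.
have Mh' := basic_construction_lambda h^-1%g.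
have fe : adjoint (f \o l2_restrict (g*H)) (l2_restrict (g*H) \o f).
  by apply: adjoint_comp => //; exact: l2_restrict_adjoint.
have Mfe := generated_vN_comp Mf Mg; have Mef := generated_vN_comp Mg Mf.
transitivity (Tr (l2_restrict (g*H) \o f \o l2_restrict (g*H))).
  have lfe := adjoint_comp (@lambda_adjoint R G h) fe.
  have := trace_tracial trace_Tr (generated_vN_comp Mh Mfe)
    (generated_vN_comp Mef Mh') lfe.
  have hVh (xi : l2 R G) : lambda h^-1%g (lambda h xi) = xi.
    by rewrite -[LHS]/((lambda _ \o lambda h) xi) -lambdaM mulVg lambda1.
  have -> : (l2_restrict (g*H) \o f \o lambda h^-1%g) \o
      (lambda h \o (f \o l2_restrict (g*H))) =
      l2_restrict (g*H) \o f \o l2_restrict (g*H) :> op.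
    by apply/funext => xi /=; rewrite hVh f_idem.
  move=> ->; congr Tr; apply/funext => xi; rewrite /compression/=.
  rewrite -(f_lambda _ Hh) l2_restrict_idem; congr (f _).
  rewrite f_lambda ?gpredV//.
  rewrite -[RHS]/((lambda h \o l2_restrict (g*H)) _).
  rewrite (@lambda_restrict _ _ h _ ((h * g)%g*H)) => [|t].
    by rewrite /= -[lambda h _]/((lambda h \o lambda h^-1%g) _) -lambdaM mulgV lambda1.
  by rewrite !left_cosetP invgM -mulgA mulKg.
have := trace_tracial trace_Tr Mfe Mef fe.
have -> : (l2_restrict (g*H) \o f) \o (f \o l2_restrict (g*H)) =
    l2_restrict (g*H) \o f \o l2_restrict (g*H) :> op.
  by apply/funext => xi /=; rewrite f_idem.
move=> ->; congr Tr; apply/funext => xi.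
by rewrite /compression/= l2_restrict_idem.
Qed.

Hypothesis Tr_f : (Tr f < +oo)%E.

(** Any $n$ distinct cosets give $nv\le\mathrm{Tr}(f)<\infty$. It serves twice: for an infinite
    double coset, and with $v=1$ to bound the number of cosets in the support of $f$. *)
Lemma infinite_coset_trace0 A (v : \bar R) : infinite_set (coset_rep H @` A) ->
  (forall g, A g -> Tr (compression (g*H)) = v) -> v = 0%E.
Proof.
move=> inf Av.
have Mfp : positive_part M f.
  split=> //; split=> // xi.
  by rewrite -f_idem f_adj inner_norm exprn_ge0.
have Trf0 := trace_ge0 trace_Tr Mfp.
have finf : Tr f \is a fin_num by rewrite ge0_fin_numE.
have repA k : (coset_rep H @` A) k -> Tr (compression (k*H)) = v /\ coset_rep H k = k.
  move=> [g Ag <-]; rewrite coset_rep_idem -(left_coset_eq (coset_rep_mem H g)).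
  by rewrite Av.
have [g Ag] : exists g, A g.
  have [[|k s] [_ //= _ /(_ _ (mem_head _ _))[g Ag _]]] :=
    infinite_set_seq 1 inf.
  by exists g.
have v0 : (0 <= v)%E.
  rewrite -(Av _ Ag); apply: (trace_ge0 trace_Tr); apply: compression_pos.
  exact: basic_construction_coset.
have vf : v \is a fin_num.
  rewrite ge0_fin_numE//; apply: le_lt_trans Tr_f; rewrite -(Av _ Ag).
  by have := @trace_compression_le [:: g] isT; rewrite big_seq1.
move: v0; rewrite -(fineK vf) => v0; congr EFin; apply/eqP.
rewrite eq_le -[X in _ && X]lee_fin v0 andbT leNgt; apply/negP => r0.
have [s [us ns sA]] :=
  infinite_set_seq (Num.truncn (fine (Tr f) / fine v)).+1 inf.
(* The entries of [s] are representatives already, so distinct entries lie in distinct cosets. *)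
have sid : map (coset_rep H) s = s.
  by apply: map_id_in => k /sA/repA[].
have := @trace_compression_le s; rewrite sid => /(_ us).
rewrite (eq_big_seq (fun=> (fine v)%:E)); last first.
  by move=> k /sA/repA[-> _]; rewrite fineK.
rewrite sumEFin big_const_seq count_predT iter_addr addr0 -mulr_natl.
rewrite -[X in (_ <= X)%E]fineK// lee_fin; apply/negP; rewrite -ltNge.
rewrite -ltr_pdivrMr//; apply: lt_le_trans (truncnS_gt _) _.
by rewrite ler_nat.
Qed.

End trace.

(** * Off-diagonal coefficients over a finite double coset *)

Section diagonal.
Context {R : realType} {G : groupType} (H : groupClosed G).
Local Notation op := (l2 R G -> l2 R G).
Variable f : op.
Hypothesis f_lambda : forall h xi, h \in H -> f (lambda h xi) = lambda h (f xi).
Hypothesis f_rho : forall h xi, h \in H -> f (rho h xi) = rho h (f xi).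
Hypothesis infinite_orbit : forall g : G, g != 1%g ->
  infinite_set [set (h * g * h^-1)%g | h in [set` H]].

Lemma finite_double_coset_diagonal g t :
  finite_set (coset_rep H @` double_coset [set` H] g) -> t != g ->
  f (delta g) t = 0.
Proof.
move=> fin tg; apply/eqP; apply: contrapT => /negP v0.
have y1 : (t * g^-1)%g != 1%g.
  move: tg; apply: contra_neq => /(congr1 (fun x => x * g)%g).
  by rewrite mulgVK mul1g.
apply: (infinite_orbit y1); apply: (finite_conj_orbit fin).
have finF := finite_image (fun x => x * g^-1)%g (finite_fiber_l2 (f (delta g)) v0).
apply: sub_finite_set finF => _ [k [Hk Hgk] <-].
(* For $k\in K$, $k(tg^{-1})k^{-1}=(kt(g^{-1}kg)^{-1})g^{-1}$, so the $K$-orbit of $tg^{-1}$ is a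
   translate of points where [f (delta g)] should take its value at [t]. *)
exists (k * t * (g^-1 * k * g)^-1)%g; last first.
  by rewrite !invgM !invgK !mulgA mulgK.
have Hk' : k^-1%g \in H by rewrite gpredV.
have Hgk' : (g^-1 * k * g)^-1%g \in H by rewrite gpredV.
rewrite /= -rhoE -[k in (k * t)%g]invgK -lambdaE.
(* The two translations together fix [delta g], because $k^{-1}g(g^{-1}kg)=g$, and $f$ commutes with
   both. *)
have -> : lambda k^-1%g (rho (g^-1 * k * g)^-1%g (f (delta g))) t = f (delta g) t.
  rewrite -f_rho// -f_lambda// rho_delta lambda_delta invgK.
  by rewrite !mulgA mulgK mulVg mul1g.
by [].
Qed.

End diagonal.

(** * The projection as restriction to a finite union of left cosets *)

Theorem theorem7p1 (R : realType) (G : groupType) (H : groupClosed G)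
    (countable_G : countable [set: G])
    (irreducible : commutant (@group_vN R G [set` H]) `&`
                   @group_vN R G [set: G] = scalar_op)
    (Tr : (l2 R G -> l2 R G) -> \bar R)
    (trace_Tr : fns_trace (basic_construction [set` H]) Tr)
    (Tr_e : Tr (l2_restrict [set` H]) = 1%E)
    (f : l2 R G -> l2 R G)
    (f_mem : (commutant (group_vN [set` H]) `&`
              basic_construction [set` H]) f)
    (f_proj : projection f)
    (f_neq0 : f <> \0)
    (Tr_f : (Tr f < +oo)%E) :
  [/\ exists k : int, Tr f = (k%:~R)%:E,
      exists (n : nat) (g : 'I_n -> G),
        is_direct_sum (range f)
          (fun i => lambda (g i) @` supported_on [set` H]) &
      exists (m : nat) (d : 'I_m -> G),
        range f = subspace_sum
          (fun j => bimodule [set` H] (double_coset [set` H] (d j))) /\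
        forall j, exists (p : nat) (c : 'I_p -> G),
          bimodule [set` H] (double_coset [set` H] (d j)) =
          subspace_sum
            (fun i : 'I_p => right_module [set` H] (left_coset (c i) [set` H]))
          :> set (l2 R G)].
Proof.
case: f_mem => f_comm Mf; have [_ f_idem f_adj] := f_proj.
have fl h xi := @f_lambda R G H f f_comm h xi.
have fr h xi := @f_rho R G H f Mf h xi.
have pos g : positive_part (basic_construction [set` H])
    (compression f (left_coset g [set` H])).
  by apply: compression_pos => //; exact: basic_construction_coset.
have diag g t : t != g -> f (delta g) t = 0.
  have [fin|inf] := pselect (finite_set (coset_rep H @` double_coset [set` H] g)).
    apply: (finite_double_coset_diagonal fl fr) => // k k1.
    exact: (irreducible_infinite_orbit irreducible).
  (* All left cosets in this infinite double coset have compressions of equal trace, so that trace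
     is 0. *)
  have Tr0 : Tr (compression f (left_coset g [set` H])) = 0%E.
    apply: (infinite_coset_trace0 trace_Tr Mf f_proj Tr_f inf) => _ [h Hh [k Hk <-]].
    rewrite -(trace_compression_lambda trace_Tr f_comm Mf f_proj g Hh).
    congr (Tr (compression f _)); symmetry; apply: left_coset_eq.
    by exists k.
  have c0 := trace_faithful trace_Tr (pos g) Tr0.
  (* By faithfulness $e_{gH}f=0$. Applied to [delta t] and read at [g], this is the conjugate of the
     wanted coefficient. *)
  move=> _; have : l2_restrict (left_coset g [set` H]) (f (delta t)) = 0.
    apply/eqP; rewrite -normr_eq0 -sqrf_eq0 -inner_compression// c0.
    by apply/eqP; apply: inner_disjoint => k; left.
  move=> /(congr1 (fun xi : l2 R G => xi g)).
  rewrite l2_restrictE mem_set ?l2_fun0; last exact: left_coset_refl.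
  move=> ftg; rewrite -[LHS]inner_deltar f_adj inner_deltal ftg.
  exact: conjc0.
pose S := [set g | f (delta g) = delta g].
have fE : f = l2_restrict S.
  apply: op_eqP => xi t; rewrite l2_restrictE -inner_deltar f_adj.
  case: ifPn => [/set_mem ->|]; first by rewrite inner_deltar.
  rewrite notin_setE => tS.
  (* Each [delta t] is an eigenvector, and idempotence makes its eigenvalue 0 or 1; [S] collects
     those with eigenvalue 1. *)
  have fc : f (delta t) = f (delta t) t *: delta t.
    apply: l2_ext => k; rewrite l2_funZ deltaE.
    by have [->|kt] := eqVneq k t; rewrite ?mulr1// mulr0 diag.
  have [c0|c0] := eqVneq (f (delta t) t) 0.
    by rewrite fc c0 scale0r; apply: inner_disjoint => k; right.
  case: tS; have [[flin _] _ _] := f_proj.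
  have : f (f (delta t)) = f (delta t) by rewrite -[LHS]/((f \o f) _) f_idem.
  rewrite {1}fc (linear_opZ flin) => /(congr1 (fun xi : l2 R G => xi t)).
  rewrite l2_funZ -[RHS]mul1r => /(mulIf c0) c1.
  by rewrite /S /= fc c1 scale1r.
have HS h t : h \in H -> S t <-> S (h * t)%g.
  have imp k u : k \in H -> S u -> S (k * u)%g.
    by move=> Hk Su; rewrite /S/= -lambda_delta fl// Su.
  move=> Hh; split; first exact: imp.
  by move=> /(imp h^-1%g); rewrite mulKg gpredV; apply.
have SH h t : h \in H -> S t <-> S (t * h)%g.
  have imp k u : k \in H -> S u -> S (u * k)%g.
    move=> Hk Su; rewrite /S/= -[k]invgK -rho_delta fr ?gpredV//.
    by rewrite Su.
  move=> Hh; split; first exact: imp.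
  by move=> /(imp h^-1%g); rewrite mulgK gpredV; apply.
have cosetS g t : S g -> left_coset g [set` H] t -> S t.
  by move=> Sg [h Hh <-]; exact: (SH h g Hh).1.
have doubleS g t : S g -> double_coset [set` H] g t -> S t.
  by move=> Sg [h Hh [k Hk <-]]; apply: (SH k _ Hk).1; exact: (HS h g Hh).1.
(* The coset of [g] lies in [S], so compressing by $f=e_S$ leaves its projection unchanged. *)
have Trc g : S g -> Tr (compression f (left_coset g [set` H])) = 1%E.
  move=> Sg; rewrite -(trace_coset trace_Tr Tr_e g); congr Tr.
  apply: op_eqP => xi t; rewrite /compression/= {1}fE !l2_restrictE fE l2_restrictE.
  case: ifPn => [tS|].
    by rewrite tS.
  rewrite notin_setE => tS; rewrite memNset// => gt.
  by apply: tS; exact: cosetS gt.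
(* Infinitely many cosets of trace 1 would give 1 = 0. *)
have finS : finite_set (coset_rep H @` S).
  apply: contrapT => inf.
  have /eqP := infinite_coset_trace0 trace_Tr Mf f_proj Tr_f inf Trc.
  by rewrite onee_eq0.
have /finite_seqP[s0 s0E] := finS; pose s := undup s0.
have sP k : k \in s <-> exists2 g, S g & coset_rep H g = k.
  by rewrite mem_undup; have -> : (k \in s0 : Prop) = [set` s0] k by []; rewrite -s0E.
have sS k : k \in s -> S k.
  by move=> /sP[g Sg <-]; apply: (cosetS g) => //; exact: coset_rep_mem.
have us : uniq (map (coset_rep H) s).
  rewrite map_id_in ?undup_uniq// => k /sP[g _ <-]; exact: coset_rep_idem.
pose n := size s; pose g (i : 'I_n) : G := tnth (in_tuple s) i.
have gS i : S (g i) by apply: sS; exact: mem_tnth.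
have gP t : S t -> exists i, left_coset (g i) [set` H] t.
  move=> St; have /tnthP[i iE] : coset_rep H t \in in_tuple s by apply/sP; exists t.
  exists i; rewrite /g -iE; rewrite -(left_coset_eq (coset_rep_mem H t)).
  exact: left_coset_refl.
have SE : S = \bigcup_i left_coset (g i) [set` H].
  apply/seteqP; split=> [t /gP[i it]|t [i _]]; first by exists i.
  exact: cosetS.
have rf : range f = supported_on S.
  by rewrite fE; have [_ ->] := @l2_restrict_projection R G S.
have rightE k : right_module [set` H] (left_coset k [set` H]) =
    supported_on (left_coset k [set` H]) :> set (l2 R G).
  by apply: right_moduleE => h t; exact: left_coset_mulr.
have biE k : bimodule [set` H] (double_coset [set` H] k) =
    supported_on (double_coset [set` H] k) :> set (l2 R G).
  by apply: bimoduleE => h t; [exact: double_coset_mull|exact: double_coset_mulr].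
split.
- exists n; have SU : S = coset_union H s.
    rewrite SE; apply/seteqP; split=> t.
      by move=> [i _ it]; exists (g i) => //; exact: mem_tnth.
    move=> [k ks kt]; have /tnthP[i ki] : k \in in_tuple s by [].
    by exists i => //; rewrite /g -ki.
  (* As the compression over all of [S], $f$ has trace the sum of the traces over the entries of
     [s], each equal to 1; the integer is the number of cosets. *)
  have <- : compression f (coset_union H s) = f.
    by apply/funext => xi; rewrite /compression -SU fE /comp !l2_restrict_idem.
  rewrite trace_compression_union// (eq_big_seq (fun=> 1%E)).
    by rewrite sumEFin big_const_seq count_predT iter_addr addr0.
  by move=> k /sS/Trc.
- exists n, g; split.
    rewrite rf SE -subspace_sum_supported_on; congr subspace_sum.
    apply/funext => i; symmetry; apply: lambda_supported_on => t.
    by rewrite left_cosetP mulKg.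
  move=> i j ij _ _ [xi Hxi <-] [eta Heta <-]; apply: inner_disjoint => t.
  have [it|it] := pselect (left_coset (g i) [set` H] t); last first.
    left; rewrite lambdaE Hxi// => Ht; apply: it; exact/left_cosetP.
  right; rewrite lambdaE Heta// => Ht.
  have jt : left_coset (g j) [set` H] t by apply/left_cosetP.
  move/negP: ij; apply; apply/eqP.
  (* A common point of the two supports would identify the cosets, whereas [us] makes those of
     distinct indices different. *)
  have : coset_rep H (g i) = coset_rep H (g j).
    by move/coset_repP: it => ->; symmetry; apply/coset_repP.
  rewrite /g !(tnth_nth 1%g) => E.
  apply: val_inj; apply/eqP; rewrite -(nth_uniq 1%g _ _ us) ?size_map ?ltn_ord//.
  by rewrite !(nth_map 1%g) ?ltn_ord//; apply/eqP; exact: E.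
- exists n, g; split.
    rewrite (_ : (fun j => _) =
      (fun j => supported_on (double_coset [set` H] (g j)))); last first.
      by apply/funext => j; exact: biE.
    rewrite rf subspace_sum_supported_on; congr supported_on.
    apply/seteqP; split=> [t /gP[i [h Hh <-]]|t [i _]]; last exact: doubleS.
    by exists i => //; apply: (double_coset_mulr _ _ Hh).1; exact: double_coset_refl.
  move=> j; pose D := double_coset [set` H] (g j).
  (* The cosets listed in [g] that lie in [D] exhaust it. Indices outside [D] are sent to [g j],
     whose coset is already in [D], so the union is unaffected. *)
  exists n, (fun i => if g i \in D then g i else g j).
  rewrite (_ : (fun i => right_module _ _) =
    (fun i => supported_on (left_coset (if g i \in D then g i else g j) [set` H])));
    last by apply/funext => i; exact: rightE.
  rewrite biE subspace_sum_supported_on; congr supported_on.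
  apply/seteqP; split=> [t Dt|t [i _]].
    have [i it] := gP t (doubleS _ _ (gS j) Dt); exists i => //.
    rewrite mem_set//; have := it; move=> [h Hh hE].
    by apply/(double_coset_mulr _ _ Hh); rewrite hE.
  case: ifPn => [/set_mem Di [h Hh <-]|_ [h Hh <-]].
    exact: (double_coset_mulr _ _ Hh).1.
  by apply: (double_coset_mulr _ _ Hh).1; exact: double_coset_refl.
Qed.
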